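(* Let $G$ be a finite group and $\mathcal{L}$ a finite honeycomb lattice with arbitrarily oriented edges on a closed orientable surface, with quantum double Hamiltonian $H_{QD}=-\sum_vA(v)-\sum_pB(p)$ on $\mathcal{H}_{\mathcal{L}}$. For every vertex $v$ and every plaquette $p$ introduce auxiliary systems $\mathcal{H}_{R^v}\cong\mathcal{H}_{R^p}\cong\mathbb{C}^{|G|}$ with orthonormal basis $\{|g\rangle\}_{g\in G}$ and $\mathcal{H}_{I^v}\cong\mathcal{H}_{I^p}\cong\mathbb{C}^6$ with orthonormal basis $\{|i\rangle\}_{i=0}^5$, $|6\rangle\equiv|0\rangle$. Let $|\Psi^v\rangle_{R^v}=\frac{1}{\sqrt{|G|}}\sum_{g\in G}|g\rangle$ and $|\Psi^p\rangle_{R^p}=|1\rangle$ with $1\in G$ the identity. For every vertex $v$ let $e_0^v,e_1^v,e_2^v$ be its incident edges in clockwise order, and for every plaquette $p$ let $e_0^p,\ldots,e_5^p$ be its boundary edges in clockwise order; put $$M_i^v=\sum_gL^g(e_i^v,v)\otimes|g\rangle\langle g|_{R^v}\ (i=0,1,2),\qquad M_i^p=\sum_gT^g(e_i^p,p)\otimes\Big(\sum_z|gz\rangle\langle z|\Big)_{R^p}\ (i=0,\ldots,5).$$ Let $H_0^v=-|\Psi^v\rangle\langle\Psi^v|_{R^v}\otimes|0\rangle\langle0|_{I^v}$, $H_0^p=-|\Psi^p\rangle\langle\Psi^p|_{R^p}\otimes|0\rangle\langle0|_{I^p}$, and $$V^v=\sum_{i=0}^2\Big((M_i^v)^\dagger\otimes|i+1\rangle\langle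 i|_{I^v}\otimes|0\rangle\langle0|_{I^{p_-(e_i^v)}}\otimes|0\rangle\langle0|_{I^{p_+(e_i^v)}}+h.c.\Big)+\sum_{i=3}^5\Big(|i+1\rangle\langle i|_{I^v}+h.c.\Big),$$ $$V^p=\sum_{i=0}^5\Big((M_i^p)^\dagger\otimes|i+1\rangle\langle i|_{I^p}\otimes|0\rangle\langle0|_{I^{v_-(e_i^p)}}\otimes|0\rangle\langle0|_{I^{v_+(e_i^p)}}+h.c.\Big),$$ where $p_\pm(e)$ are the two plaquettes separated by the edge $e$ and $v_\pm(e)$ its two endpoints. Consider $H=\sum_pH_0^p+\sum_vH_0^v+\lambda\big(\sum_vV^v+\sum_pV^p\big)$, with unperturbed part $\sum_pH_0^p+\sum_vH_0^v$. Then there is a function $f(\lambda)$ such that, for sufficiently small $\lambda$, $$\tilde H_{\mathrm{eff}}(f(\lambda))=2\lambda^6\,H_{QD}\otimes\Big(\bigotimes_v|\Psi^v\rangle\langle\Psi^v|_{R^v}\otimes|0\rangle\langle0|_{I^v}\Big)\otimes\Big(\bigotimes_p|\Psi^p\rangle\langle\Psi^p|_{R^p}\otimes|0\rangle\langle0|_{I^p}\Big)+O(\lambda^7).$$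
   Context: Quantum double model: to every oriented edge $e$ of the lattice $\mathcal{L}$ associate a space $\mathbb{C}^{|G|}$ with orthonormal basis $\{|g\rangle_e\}_{g\in G}$; $\mathcal{H}_{\mathcal{L}}$ is the tensor product over all edges. On edge $e$ define $L_+^g(e)=\sum_z|gz\rangle\langle z|_e$, $L_-^g(e)=\sum_z|zg^{-1}\rangle\langle z|_e$, $T_+^h(e)=|h\rangle\langle h|_e$, $T_-^h(e)=|h^{-1}\rangle\langle h^{-1}|_e$. If $e$ is directed from $v_-=v_-(e)$ to $v_+=v_+(e)$ (distinct vertices) and separates the (distinct) plaquettes $p_-=p_-(e)$ on its left and $p_+=p_+(e)$ on its right, put $L^g(e,v_\pm)=L^g_\pm(e)$ and $T^h(e,p_\pm)=T^h_\pm(e)$. Then $A(v)=\frac{1}{|G|}\sum_{g\in G}\prod_{e\in\mathrm{star}(v)}L^g(e,v)$, where $\mathrm{star}(v)$ is the set of edges incident to $v$, and $B(p)=\sum_{g_{k-1}\cdots g_0=1}\prod_{i=0}^{k-1}T^{g_i}(\tilde e_i,p)$, where $\tilde e_0,\ldots,\tilde e_{k-1}$ are the boundary edges of $p$ in clockwise order (the starting edge is irrelevant). In a honeycomb lattice each vertex has 3 incident edges and each plaquette 6 boundary edges. Identity operators on systems acted on trivially are omitted; h.c. denotes the Hermitian conjugate of the preceding term. Effective Hamiltonian: let $H_0$ be a Hermitian operator with $d$-dimensional ground space (eigenspace of the smallest eigenvalue), $V$ Hermitian, and $H=H_0+\lambda V$. Let $|\varphi_1\rangle,\ldots,|\varphi_d\rangle$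 be orthonormal eigenvectors of $H$ corresponding to its $d$ lowest eigenvalues $E_1,\ldots,E_d$ (counted with multiplicity). Put $H_{\mathrm{eff}}=\sum_{i=1}^dE_i|\varphi_i\rangle\langle\varphi_i|$, $\Pi=\sum_{i=1}^d|\varphi_i\rangle\langle\varphi_i|$, and $\tilde H_{\mathrm{eff}}(\delta)=H_{\mathrm{eff}}-\delta\,\Pi$ for real $\delta$. $O(\lambda^k)$ denotes an operator of norm at most a constant times $|\lambda|^k$ as $\lambda\to0$.
   Formalization: For nonabelian G the claim fails with e_0^p,…,e_5^p clockwise (V^p selects g_0…g_5=1, while B(p) needs g_5…g_0=1); it is proved with e_0^p,…,e_5^p counterclockwise for every G, and with the stated clockwise order when G is abelian. *)

(* Defs.v *)
(* Operators on a finite-dimensional Hilbert space with an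
   orthonormal basis indexed by a finite type D are matrices of size #|D| over
   R[i], with R : realType (so R[i] is the field of complex numbers). *)
From HB Require Import structures.
From mathcomp Require Import all_boot all_order all_algebra all_fingroup.
From mathcomp Require Import reals.
From mathcomp Require Export complex.

Set Implicit Arguments.
Unset Strict Implicit.
Unset Printing Implicit Defensive.

Import Order.TTheory GRing.Theory Num.Theory.

Local Open Scope ring_scope.
Local Open Scope complex_scope.
Local Open Scope sesquilinear_scope.

Notation "''Op[' R ']_' D" := 'M[R[i]]_#|D|
  (at level 8, R at level 2, D at level 2, format "''Op[' R ]_ D") : type_scope.

Definition dagger (R : realType) m n (A : 'M[R[i]]_(m, n)) : 'M[R[i]]_(n, m) :=
  A ^t*.

Definition ketbra (R : realType) (D : finType) (a b : D) : 'Op[R]_D :=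
  delta_mx (enum_rank a) (enum_rank b).

Definition ground_energy (R : realType) n (H : 'M[R[i]]_n) (E0 : R) : Prop :=
  eigenvalue H E0%:C /\ forall b : R, eigenvalue H b%:C -> E0 <= b.

(* All eigenvalues of H, counted with multiplicity and listed in nondecreasing
   order, with corresponding orthonormal eigenvectors. *)
Definition sorted_eigenbasis (R : realType) n (H : 'M[R[i]]_n)
    (E : 'I_n -> R) (phi : 'I_n -> 'cV[R[i]]_n) : Prop :=
  [/\ forall i j, dagger (phi i) *m phi j = (i == j)%:R%:M,
      forall i, H *m phi i = (E i)%:C *: phi i &
      forall i j : 'I_n, (i <= j)%N -> E i <= E j].

(* Heff and Pi are built from some choice of orthonormal eigenvectors of
   H0 + lam V for its d lowest eigenvalues, d being the dimension of the ground
   space of H0.  Such a choice exists whenever H0 and V are Hermitian. *)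
Definition effective_hamiltonian (R : realType) n (H0 V : 'M[R[i]]_n) (lam : R)
    (Heff Pi : 'M[R[i]]_n) : Prop :=
  exists (E0 : R) (E : 'I_n -> R) (phi : 'I_n -> 'cV[R[i]]_n),
    let d := \rank (eigenspace H0 E0%:C) in
    [/\ ground_energy H0 E0,
        sorted_eigenbasis (H0 + lam%:C *: V) E phi,
        Heff = \sum_(i < n | (i < d)%N) (E i)%:C *: (phi i *m dagger (phi i)) &
        Pi = \sum_(i < n | (i < d)%N) (phi i *m dagger (phi i))].

Definition l2norm (R : realType) n (psi : 'cV[R[i]]_n) : R[i] :=
  sqrtC (\sum_i `|psi i 0| ^+ 2).

Definition opnorm_le (R : realType) n (A : 'M[R[i]]_n) (c : R) : Prop :=
  forall psi : 'cV[R[i]]_n, l2norm (A *m psi) <= c%:C * l2norm psi.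

(* The dart (e, true) is the edge e traversed in its own direction, (e, false)
   is e traversed backwards; a dart starts at its source vertex. *)
Definition dart (E : finType) : finType := (E * bool)%type.

Definition rev_dart (E : finType) (d : dart E) : dart E := (d.1, ~~ d.2).

Lemma rev_dartK (E : finType) : involutive (@rev_dart E).
Proof. by case=> e b; rewrite /rev_dart negbK. Qed.

Definition revp (E : finType) : {perm dart E} := perm (can_inj (@rev_dartK E)).

(* A lattice is given by the permutation rot which sends a dart to the next dart
   with the same source, clockwise around that vertex.  Then face sends a dart d
   to the next dart, in clockwise order, along the boundary of the plaquette on
   the right of d: at the end of d one leaves along the dart that follows the
   reverse of d counterclockwise. *)
Definition face (E : finType) (rot : {perm dart E}) : {perm dart E} :=
  (revp E * rot^-1)%g.

(* A vertex is the set of darts with this source, a plaquette is the set of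
   darts having it on their right. *)
Definition vertex (E : finType) (rot : {perm dart E}) : finType :=
  {v : {set dart E} | v \in porbits rot}.

Definition plaquette (E : finType) (rot : {perm dart E}) : finType :=
  {p : {set dart E} | p \in porbits (face rot)}.

Lemma porbit_mem (T : finType) (s : {perm T}) (x : T) : porbit s x \in porbits s.
Proof. exact: imset_f. Qed.

Definition source (E : finType) (rot : {perm dart E}) (d : dart E) : vertex rot :=
  exist _ (porbit rot d) (porbit_mem rot d).

Definition right_of (E : finType) (rot : {perm dart E}) (d : dart E) :
    plaquette rot :=
  exist _ (porbit (face rot) d) (porbit_mem (face rot) d).

Definition vminus (E : finType) (rot : {perm dart E}) (e : E) : vertex rot :=
  source rot (e, true).
Definition vplus (E : finType) (rot : {perm dart E}) (e : E) : vertex rot :=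
  source rot (e, false).
Definition pminus (E : finType) (rot : {perm dart E}) (e : E) : plaquette rot :=
  right_of rot (e, false).
Definition pplus (E : finType) (rot : {perm dart E}) (e : E) : plaquette rot :=
  right_of rot (e, true).

Definition honeycomb (E : finType) (rot : {perm dart E}) : Prop :=
  [/\ forall d, #|porbit rot d| = 3,
      forall d, #|porbit (face rot) d| = 6,
      forall e, vminus rot e != vplus rot e &
      forall e, pminus rot e != pplus rot e].

Definition star (E : finType) (rot : {perm dart E}) (v : vertex rot) : {set E} :=
  [set e | (v == vminus rot e) || (v == vplus rot e)].

Definition clockwise_star (E : finType) (rot : {perm dart E}) (v : vertex rot)
    (e : 'I_3 -> E) : Prop :=
  exists2 d, d \in val v & forall i : 'I_3, e i = ((rot ^+ i)%g d).1.

Definition clockwise_boundary (E : finType) (rot : {perm dart E})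
    (p : plaquette rot) (e : 'I_6 -> E) : Prop :=
  exists2 d, d \in val p & forall i : 'I_6, e i = ((face rot ^+ i)%g d).1.

Definition counterclockwise_boundary (E : finType) (rot : {perm dart E})
    (p : plaquette rot) (e : 'I_6 -> E) : Prop :=
  exists2 d, d \in val p & forall i : 'I_6, e i = (((face rot)^-1 ^+ i)%g d).1.

(* There is one copy of C^|G| for every edge e (inl e), for every vertex v (the
   system R^v, inr (inl v)) and for every plaquette p (the system R^p,
   inr (inr p)), and one copy of C^6 for every vertex (I^v) and every plaquette
   (I^p).  The full Hilbert space has the product basis. *)
Definition gsite (E : finType) (rot : {perm dart E}) : finType :=
  (E + (vertex rot + plaquette rot))%type.
Definition isite (E : finType) (rot : {perm dart E}) : finType :=
  (vertex rot + plaquette rot)%type.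

Definition config (G : finGroupType) (E : finType) (rot : {perm dart E}) : finType :=
  ({ffun gsite rot -> G} * {ffun isite rot -> 'I_6})%type.

(* The operator A on the copy of C^|G| (resp. C^6) at s, tensored with the
   identity on all other systems. *)
Definition atG (R : realType) (G : finGroupType) (E : finType)
    (rot : {perm dart E}) (s : gsite rot) (A : 'Op[R]_G) : 'Op[R]_(config G rot) :=
  \matrix_(i, j)
    let x : config G rot := enum_val i in
    let y : config G rot := enum_val j in
    if [forall t, (t != s) ==> (x.1 t == y.1 t)] && (x.2 == y.2)
    then A (enum_rank (x.1 s)) (enum_rank (y.1 s)) else 0.

Definition atI (R : realType) (G : finGroupType) (E : finType)
    (rot : {perm dart E}) (s : isite rot) (A : 'Op[R]_'I_6) :
    'Op[R]_(config G rot) :=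
  \matrix_(i, j)
    let x : config G rot := enum_val i in
    let y : config G rot := enum_val j in
    if (x.1 == y.1) && [forall t, (t != s) ==> (x.2 t == y.2 t)]
    then A (enum_rank (x.2 s)) (enum_rank (y.2 s)) else 0.

Definition Lplus (R : realType) (G : finGroupType) (g : G) : 'Op[R]_G :=
  \sum_z ketbra R (g * z)%g z.
Definition Lminus (R : realType) (G : finGroupType) (g : G) : 'Op[R]_G :=
  \sum_z ketbra R (z * g^-1)%g z.
Definition Tplus (R : realType) (G : finGroupType) (h : G) : 'Op[R]_G :=
  ketbra R h h.
Definition Tminus (R : realType) (G : finGroupType) (h : G) : 'Op[R]_G :=
  ketbra R h^-1%g h^-1%g.

(* L^g(e, v) for v an endpoint of e, and T^h(e, p) for p adjacent to e. *)
Definition Lop (R : realType) (G : finGroupType) (E : finType)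
    (rot : {perm dart E}) (g : G) (e : E) (v : vertex rot) :
    'Op[R]_(config G rot) :=
  atG (inl e) (if v == vplus rot e then Lplus R g else Lminus R g).

Definition Top (R : realType) (G : finGroupType) (E : finType)
    (rot : {perm dart E}) (h : G) (e : E) (p : plaquette rot) :
    'Op[R]_(config G rot) :=
  atG (inl e) (if p == pplus rot e then Tplus R h else Tminus R h).

(* In \prod over a set of edges the factors commute. *)
Definition Avertex (R : realType) (G : finGroupType) (E : finType)
    (rot : {perm dart E}) (v : vertex rot) : 'Op[R]_(config G rot) :=
  (#|G|%:R)^-1 *: \sum_(g : G) \prod_(e in star v) Lop R g e v.

(* et lists the boundary edges of p in clockwise order, and the sum runs over
   the g with g_5 g_4 ... g_0 = 1. *)
Definition Bplaquette (R : realType) (G : finGroupType) (E : finType)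
    (rot : {perm dart E}) (p : plaquette rot) (et : 'I_6 -> E) :
    'Op[R]_(config G rot) :=
  \sum_(g : {ffun 'I_6 -> G} | (\prod_(i < 6) g (rev_ord i) == 1)%g)
    \prod_(i < 6) Top R (g i) (et i) p.

(* As an operator on the full Hilbert space, identity on the auxiliary systems. *)
Definition HQD (R : realType) (G : finGroupType) (E : finType)
    (rot : {perm dart E}) (et : plaquette rot -> 'I_6 -> E) :
    'Op[R]_(config G rot) :=
  - (\sum_(v : vertex rot) Avertex R G v)
  - (\sum_(p : plaquette rot) Bplaquette R G p (et p)).

(* The index i of |i>, with 6 identified with 0. *)
Definition idx6 (i : nat) : 'I_6 := inord (i %% 6).

Definition step6 (R : realType) (i : nat) : 'Op[R]_'I_6 :=
  ketbra R (idx6 i.+1) (idx6 i).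
Definition zero6 (R : realType) : 'Op[R]_'I_6 := ketbra R (idx6 0) (idx6 0).

Definition PsiV (R : realType) (G : finGroupType) : 'cV[R[i]]_#|G| :=
  (sqrtC #|G|%:R)^-1 *: \sum_(g : G) delta_mx (enum_rank g) 0.
Definition projPsiV (R : realType) (G : finGroupType) : 'Op[R]_G :=
  PsiV R G *m dagger (PsiV R G).
Definition projPsiP (R : realType) (G : finGroupType) : 'Op[R]_G :=
  ketbra R (1%g : G) 1%g.

Definition projV (R : realType) (G : finGroupType) (E : finType)
    (rot : {perm dart E}) (v : vertex rot) : 'Op[R]_(config G rot) :=
  atG (inr (inl v)) (projPsiV R G) * atI G (inl v) (zero6 R).
Definition projP (R : realType) (G : finGroupType) (E : finType)
    (rot : {perm dart E}) (p : plaquette rot) : 'Op[R]_(config G rot) :=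
  atG (inr (inr p)) (projPsiP R G) * atI G (inr p) (zero6 R).

Definition MV (R : realType) (G : finGroupType) (E : finType)
    (rot : {perm dart E}) (v : vertex rot) (e : E) : 'Op[R]_(config G rot) :=
  \sum_(g : G) Lop R g e v * atG (inr (inl v)) (ketbra R g g).
Definition MP (R : realType) (G : finGroupType) (E : finType)
    (rot : {perm dart E}) (p : plaquette rot) (e : E) : 'Op[R]_(config G rot) :=
  \sum_(g : G) Top R g e p *
    atG (inr (inr p)) (\sum_(z : G) ketbra R (g * z)%g z).

Definition plus_hc (R : realType) n (A : 'M[R[i]]_n) : 'M[R[i]]_n := A + dagger A.

Definition VV (R : realType) (G : finGroupType) (E : finType)
    (rot : {perm dart E}) (v : vertex rot) (e : 'I_3 -> E) :
    'Op[R]_(config G rot) :=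
  \sum_(i < 3) plus_hc (dagger (MV R G v (e i)) * atI G (inl v) (step6 R i)
                        * atI G (inr (pminus rot (e i))) (zero6 R)
                        * atI G (inr (pplus rot (e i))) (zero6 R))
  + \sum_(3 <= i < 6) plus_hc (atI G (inl v) (step6 R i)).
(* Pitfall: along the cycle 0 -> 1 -> ... -> 5 -> 0 of I^p the system R^p picks up
   <1| M_5^dag ... M_0^dag |1>, which selects g_0 g_1 ... g_5 = 1, the reverse of
   the order in Bplaquette.  So for nonabelian G the list e must run
   counterclockwise around p. *)
Definition VP (R : realType) (G : finGroupType) (E : finType)
    (rot : {perm dart E}) (p : plaquette rot) (e : 'I_6 -> E) :
    'Op[R]_(config G rot) :=
  \sum_(i < 6) plus_hc (dagger (MP R G p (e i)) * atI G (inr p) (step6 R i)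
                        * atI G (inl (vminus rot (e i))) (zero6 R)
                        * atI G (inl (vplus rot (e i))) (zero6 R)).

Definition Hunperturbed (R : realType) (G : finGroupType) (E : finType)
    (rot : {perm dart E}) : 'Op[R]_(config G rot) :=
  \sum_(p : plaquette rot) (- projP R G p) + \sum_(v : vertex rot) (- projV R G v).

Definition Vperturbation (R : realType) (G : finGroupType) (E : finType)
    (rot : {perm dart E}) (ev : vertex rot -> 'I_3 -> E)
    (ep : plaquette rot -> 'I_6 -> E) : 'Op[R]_(config G rot) :=
  \sum_(v : vertex rot) VV R G v (ev v) + \sum_(p : plaquette rot) VP R G p (ep p).

Definition projAux (R : realType) (G : finGroupType) (E : finType)
    (rot : {perm dart E}) : 'Op[R]_(config G rot) :=
  (\prod_(v : vertex rot) projV R G v) * (\prod_(p : plaquette rot) projP R G p).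

(* Main.v *)
(** Up to a constant the unperturbed Hamiltonian is the number
    [D = \sum_s (1 - P_s)] of violated local projections, with ground projection
    [P = \prod_s P_s]; call [I^s] the clock of the site [s].  All the gates [M_i]
    permute the product basis, so a clock that moves forward and back undoes its
    gates.  Lift the clock positions from [Z/6] to [Z] and attach to a family [n]
    of positions the state obtained from [P] by the gates met on the way.  The
    projections onto [|0>] in [V] allow a hop only when its gate commutes with all
    the gates already applied at the other sites; hence, as long as every position
    is at most 5 in absolute value, [V] acts on the lifted states by scalar hopping
    and [D] multiplies them by the number of nonzero positions.  The perturbation
    series is therefore a scalar energy shift through order 5.  At order 6 the only
    new paths are the two full turns of one clock, whose compression by [P_s] is
    [A(v) P] or [B(p) P]; the five energy denominators give the sign [-1].

    The truncated series [W] satisfies [(H - f) W = 2 l^6 H_QD P + O(l^7)] and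
    [W = P + O(l)].  By the spectral gap of [H], [(1 - Pi) W = O(l^6)], and since
    [Pi] and [P] have the same rank, [Pi = P + O(l)].  Finally
    [(H - f) Pi = Pi (H - f) W Pi + (H - f) Pi (Pi - W) Pi], and the last term
    can be absorbed. *)

(* The obstacle is that [f] must be a scalar although the unperturbed ground space is highly
   degenerate. What saves it: on a lifted state with all positions at most 5 in absolute value, [D]
   acts as a positive integer, unless all positions are 0 and the state is [P] itself. So at each
   order the source of the recursion can be solved up to a real multiple of [P], and this multiple
   is the next coefficient of [f]; no overlap between states is ever computed.

   Almost nothing else about the series has to be known. Only the states in which one clock has
   always moved in the same direction can reach position 6, and their coefficient at order k is
   [(-1) ^+ k], since such a state has exactly one defect and all its energy denominators are 1. At
   position 6 lift and clock part company: the residue is 0 again while the gates of the turn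
   remain. The factor 2 counts the two senses of rotation.

   In the passage from [W] to [Pi], the identity for [(H - f) Pi] serves twice: absorbing its last
   term gives [O(l^6)], and this crude bound then makes that same term [O(l^7)]. *)
Require Import Defs.
From mathcomp Require Import all_boot all_order all_algebra all_fingroup.
From mathcomp Require Import reals.
From mathcomp Require Import ring lra zify.

Import Order.TTheory GRing.Theory Num.Theory.
Local Open Scope ring_scope.
Local Open Scope complex_scope.

Set Implicit Arguments.
Unset Strict Implicit.
Unset Printing Implicit Defensive.

Import ComplexField.Normc.

(** * Asymptotics in the entrywise norm *)

Section EntrywiseNorm.
Variable R : realType.
Implicit Types z : R[i].

Lemma normc_normr z : `|z| = (normc z)%:C.
Proof. by []. Qed.

Lemma normc_ge0 z : 0 <= normc z.
Proof. by rewrite -lecR -normc_normr normr_ge0. Qed.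

Lemma normc_real (x : R) : normc x%:C = `|x|.
Proof. by rewrite /= expr0n /= addr0 sqrtr_sqr. Qed.

Lemma ler_normc_sum (I : Type) (r : seq I) (p : pred I) (F : I -> R[i]) :
  normc (\sum_(i <- r | p i) F i) <= \sum_(i <- r | p i) normc (F i).
Proof.
elim/big_rec2: _ => [|i y x _ le_xy]; first by rewrite normc0.
by apply: le_trans (le_normcD _ _) _; rewrite lerD2l.
Qed.

(** A finite sum of moduli is submultiplicative and dominates the operator norm. In a fixed
    dimension this is all that an [O(l^7)] estimate asks for. *)
Definition nrm m n (A : 'M[R[i]]_(m, n)) : R := \sum_i \sum_j normc (A i j).

Lemma nrm_ge0 m n (A : 'M[R[i]]_(m, n)) : 0 <= nrm A.
Proof. by do 2!apply: sumr_ge0 => ? _; exact: normc_ge0. Qed.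

Lemma normc_le_nrm m n (A : 'M[R[i]]_(m, n)) i j : normc (A i j) <= nrm A.
Proof.
rewrite /nrm (bigD1 i) //= (bigD1 j) //= -addrA lerDl addr_ge0 //.
  by apply: sumr_ge0 => ? _; exact: normc_ge0.
by do 2!apply: sumr_ge0 => ? _; exact: normc_ge0.
Qed.

Lemma nrm_le_entries m n (A : 'M[R[i]]_(m, n)) (c : R) :
  (forall i j, normc (A i j) <= c) -> nrm A <= m%:R * (n%:R * c).
Proof.
move=> le_c; rewrite mulr_natl -[X in _ *+ X]card_ord -sumr_const.
apply: ler_sum => i _; rewrite mulr_natl -[X in _ *+ X]card_ord -sumr_const.
exact: ler_sum.
Qed.

Lemma nrmD m n (A B : 'M[R[i]]_(m, n)) : nrm (A + B) <= nrm A + nrm B.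
Proof.
rewrite /nrm -big_split; apply: ler_sum => i _ /=; rewrite -big_split.
by apply: ler_sum => j _ /=; rewrite mxE; exact: le_normcD.
Qed.

Lemma nrmZ m n (c : R[i]) (A : 'M[R[i]]_(m, n)) : nrm (c *: A) = normc c * nrm A.
Proof.
rewrite /nrm mulr_sumr; apply: eq_bigr => i _; rewrite mulr_sumr.
by apply: eq_bigr => j _; rewrite mxE normcM.
Qed.

Lemma nrm0 m n : nrm (0 : 'M[R[i]]_(m, n)) = 0.
Proof. by rewrite -(scale0r 0) nrmZ normc0 mul0r. Qed.

Lemma nrmN m n (A : 'M[R[i]]_(m, n)) : nrm (- A) = nrm A.
Proof. by rewrite -scaleN1r nrmZ normcN normc1 mul1r. Qed.

Lemma nrmM m n p (A : 'M[R[i]]_(m, n)) (B : 'M[R[i]]_(n, p)) :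
  nrm (A *m B) <= nrm A * nrm B.
Proof.
rewrite /nrm mulr_suml; apply: ler_sum => i _.
apply: (@le_trans _ _ (\sum_k \sum_j normc (A i j) * normc (B j k))).
  apply: ler_sum => k _; rewrite mxE; apply: le_trans (ler_normc_sum _ _ _) _.
  by apply: ler_sum => j _; rewrite normcM.
rewrite exchange_big /= mulr_suml; apply: ler_sum => j _; rewrite -mulr_sumr.
rewrite ler_wpM2l ?normc_ge0 // (bigD1 j) //= lerDl.
by do 2!apply: sumr_ge0 => ? _; exact: normc_ge0.
Qed.

(** Each entry of [A *m psi] is at most the corresponding row sum times the length of [psi], and the
    sum of the squared row sums is at most the square of their sum. *)
Lemma opnorm_le_nrm n (A : 'M[R[i]]_n) (c : R) : nrm A <= c -> opnorm_le A c.
Proof.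
move=> le_c psi; rewrite /l2norm; set S := \sum_i `|psi i 0| ^+ 2.
have S0 : 0 <= S by apply: sumr_ge0 => i _; rewrite exprn_ge0.
have le_psi j : `|psi j 0| <= sqrtC S.
  rewrite -(@ler_pXn2r _ 2) ?nnegrE ?sqrtC_ge0 // sqrtCK /S (bigD1 j) //= lerDl.
  by apply: sumr_ge0 => i _; rewrite exprn_ge0.
have c0 : 0 <= c by apply: le_trans le_c; exact: nrm_ge0.
have cC0 : 0 <= c%:C :> R[i] by rewrite lecR.
have csum0 i : 0 <= (\sum_j normc (A i j))%:C :> R[i].
  by rewrite lecR; apply: sumr_ge0 => ? _; exact: normc_ge0.
have row_le i : `|(A *m psi) i 0| <= (\sum_j normc (A i j))%:C * sqrtC S.
  rewrite mxE; apply: le_trans (ler_norm_sum _ _ _) _.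
  rewrite raddf_sum /= mulr_suml; apply: ler_sum => j _; rewrite normrM.
  by rewrite -normc_normr ler_wpM2l.
rewrite -(@ler_pXn2r _ 2) ?nnegrE ?mulr_ge0 ?sqrtC_ge0 //; last first.
  by apply: sumr_ge0 => i _; rewrite exprn_ge0.
rewrite sqrtCK exprMn.
apply: (@le_trans _ _ (\sum_i ((\sum_j normc (A i j))%:C ^+ 2 * sqrtC S ^+ 2))).
  apply: ler_sum => i _; rewrite -exprMn ler_pXn2r ?nnegrE ?mulr_ge0 ?sqrtC_ge0 //.
rewrite -mulr_suml ler_wpM2r ?exprn_ge0 ?sqrtC_ge0 //.
apply: (@le_trans _ _ ((nrm A)%:C ^+ 2)); last first.
  by rewrite ler_pXn2r ?nnegrE ?lecR // nrm_ge0.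
rewrite [X in _ <= X]expr2 {1}/nrm raddf_sum /= mulr_suml; apply: ler_sum => i _.
rewrite expr2; apply: ler_wpM2l => //; rewrite [leRHS](bigD1 i) //= lerDl.
exact: sumr_ge0.
Qed.

End EntrywiseNorm.

Section BigO.
Variables (R : realType) (I : Type) (good : I -> Prop) (lam : I -> R).

(* [I] carries, besides the coupling [lam i], the choice of an eigenbasis of the
   perturbed operator, so that the constants do not depend on this choice. *)
Definition bigO m n k (F : I -> 'M[R[i]]_(m, n)) : Prop :=
  exists C d : R, [/\ 0 <= C, 0 < d &
    forall i, good i -> `|lam i| < d -> nrm (F i) <= C * `|lam i| ^+ k].

Lemma bigO_const m n (A : 'M[R[i]]_(m, n)) : bigO 0 (fun _ => A).
Proof.
by exists (nrm A), 1; split=> // [|i _ _]; rewrite ?nrm_ge0 // expr0 mulr1.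
Qed.

Lemma bigO_bounded m n (C : R) (F : I -> 'M[R[i]]_(m, n)) :
  (forall i, good i -> nrm (F i) <= C) -> bigO 0 F.
Proof.
move=> le_C; exists (Num.max C 0), 1; split=> // [|i gi _].
  by rewrite le_max lexx orbT.
by rewrite expr0 mulr1 le_max le_C.
Qed.

Lemma bigO_ext m n k (F F' : I -> 'M[R[i]]_(m, n)) :
  (forall i, good i -> F i = F' i) -> bigO k F -> bigO k F'.
Proof.
move=> eqF [C [d [C0 d0 le_F]]]; exists C, d; split=> // i gi ld.
by rewrite -eqF // le_F.
Qed.

Lemma bigO_D m n k (F F' : I -> 'M[R[i]]_(m, n)) :
  bigO k F -> bigO k F' -> bigO k (fun i => F i + F' i).
Proof.
move=> [C [d [C0 d0 le_F]]] [C' [d' [C0' d0' le_F']]].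
exists (C + C'), (Num.min d d'); split=> [||i gi]; first exact: addr_ge0.
  by rewrite lt_min d0.
rewrite lt_min => /andP[ld ld']; apply: le_trans (nrmD _ _) _.
by rewrite mulrDl lerD ?le_F ?le_F'.
Qed.

Lemma bigO_N m n k (F : I -> 'M[R[i]]_(m, n)) : bigO k F -> bigO k (fun i => - F i).
Proof.
move=> [C [d [C0 d0 le_F]]]; exists C, d; split=> // i gi ld.
by rewrite nrmN le_F.
Qed.

Lemma bigO_B m n k (F F' : I -> 'M[R[i]]_(m, n)) :
  bigO k F -> bigO k F' -> bigO k (fun i => F i - F' i).
Proof. by move=> OF OF'; apply: bigO_D => //; exact: bigO_N. Qed.

Lemma bigO_sum m n k (J : Type) (r : seq J) (p : pred J)
    (F : J -> I -> 'M[R[i]]_(m, n)) :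
  (forall j, p j -> bigO k (F j)) -> bigO k (fun i => \sum_(j <- r | p j) F j i).
Proof.
move=> OF; elim: r => [|j r IHr].
  exists 0, 1; split=> // i _ _; by rewrite big_nil nrm0 mul0r.
have [pj|npj] := boolP (p j).
  apply: bigO_ext (bigO_D (OF j pj) IHr) => i _ /=; by rewrite big_cons pj.
by apply: bigO_ext IHr => i _; rewrite big_cons (negbTE npj).
Qed.

Lemma bigO_M m n p k l (F : I -> 'M[R[i]]_(m, n)) (F' : I -> 'M[R[i]]_(n, p)) :
  bigO k F -> bigO l F' -> bigO (k + l) (fun i => F i *m F' i).
Proof.
move=> [C [d [C0 d0 le_F]]] [C' [d' [C0' d0' le_F']]].
exists (C * C'), (Num.min d d'); split=> [||i gi]; first exact: mulr_ge0.
  by rewrite lt_min d0.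
rewrite lt_min => /andP[ld ld']; apply: le_trans (nrmM _ _) _.
by rewrite exprD mulrACA ler_pM ?nrm_ge0 ?le_F ?le_F'.
Qed.

Lemma bigO_powZ m n k l (F : I -> 'M[R[i]]_(m, n)) :
  bigO l F -> bigO (k + l) (fun i => (lam i ^+ k)%:C *: F i).
Proof.
move=> [C [d [C0 d0 le_F]]]; exists C, d; split=> // i gi ld.
by rewrite nrmZ normc_real normrX exprD mulrCA ler_wpM2l ?exprn_ge0 ?le_F.
Qed.

Lemma bigO_le m n k l (F : I -> 'M[R[i]]_(m, n)) : (k <= l)%N -> bigO l F -> bigO k F.
Proof.
move=> lekl [C [d [C0 d0 le_F]]]; exists C, (Num.min d 1); split=> // [|i gi].
  by rewrite lt_min d0 ltr01.
rewrite lt_min => /andP[ld l1]; apply: le_trans (le_F i gi ld) _.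
by rewrite ler_wpM2l // ler_wiXn2l // ltW.
Qed.

(** Once [nrm (Z i)] is at most 1/2, the term [F i *m Z i] can be moved to the left, which costs a
    factor 2. *)
Lemma bigO_absorb n p k (F Y : I -> 'M[R[i]]_(n, p)) (Z : I -> 'M[R[i]]_p) :
  bigO k Y -> bigO 1 Z -> (forall i, good i -> F i = Y i + F i *m Z i) ->
  bigO k F.
Proof.
move=> [C [d [C0 d0 le_Y]]] [C' [d' [C0' d0' le_Z]]] eqF.
(* Below this threshold [C' * |lam i|] is at most 1/2; the [+ 1] keeps the denominator positive when
   [C' = 0]. *)
exists (2 * C), (Num.min (Num.min d d') (1 / (2 * (C' + 1)))).
have C'1 : 0 < 2 * (C' + 1) by rewrite mulr_gt0 // ltr_wpDl.
split=> [||i gi]; first exact: mulr_ge0.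
  by rewrite !lt_min d0 d0' divr_gt0.
rewrite !lt_min => /andP[/andP[ld ld']]; rewrite ltr_pdivlMr // => l1.
have {le_Y}leY := le_Y i gi ld; have {le_Z}leZ := le_Z i gi ld'.
have leF : nrm (F i) <= nrm (Y i) + nrm (F i) * nrm (Z i).
  by rewrite {1}eqF //; apply: le_trans (nrmD _ _) _; rewrite lerD2l nrmM.
have Zhalf : nrm (Z i) <= 1 / 2.
  apply: le_trans leZ _; rewrite expr1.
  have := normr_ge0 (lam i); nra.
have F0 := nrm_ge0 (F i); have Z0 := nrm_ge0 (Z i).
rewrite -mulrA; nra.
Qed.

End BigO.

(** * Spectral theory of Hermitian matrices *)

Section Dagger.
Variable R : realType.
Local Notation C := R[i].

Lemma daggerE m n (A : 'M[C]_(m, n)) i j : dagger A i j = Num.conj (A j i).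
Proof. by rewrite !mxE. Qed.

Lemma daggerM m n p (A : 'M[C]_(m, n)) (B : 'M[C]_(n, p)) :
  dagger (A *m B) = dagger B *m dagger A.
Proof. by rewrite /dagger trmx_mul map_mxM. Qed.

Lemma daggerD m n (A B : 'M[C]_(m, n)) : dagger (A + B) = dagger A + dagger B.
Proof. by apply/matrixP=> i j; rewrite !mxE rmorphD. Qed.

Lemma daggerN m n (A : 'M[C]_(m, n)) : dagger (- A) = - dagger A.
Proof. by apply/matrixP=> i j; rewrite !mxE rmorphN. Qed.

Lemma daggerZ m n (c : C) (A : 'M[C]_(m, n)) :
  dagger (c *: A) = Num.conj c *: dagger A.
Proof. by apply/matrixP=> i j; rewrite !mxE rmorphM. Qed.

Lemma daggerK m n (A : 'M[C]_(m, n)) : dagger (dagger A) = A.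
Proof. by apply/matrixP=> i j; rewrite !mxE conjCK. Qed.

Lemma dagger1 n : dagger (1%:M : 'M[C]_n) = 1%:M.
Proof. by apply/matrixP=> i j; rewrite !mxE eq_sym rmorph_nat. Qed.

Lemma dagger0 m n : dagger (0 : 'M[C]_(m, n)) = 0.
Proof. by apply/matrixP=> i j; rewrite !mxE rmorph0. Qed.

Lemma dagger_sum m n (I : Type) (r : seq I) (p : pred I) (F : I -> 'M[C]_(m, n)) :
  dagger (\sum_(i <- r | p i) F i) = \sum_(i <- r | p i) dagger (F i).
Proof. by apply: (big_morph _ (@daggerD m n) (@dagger0 m n)). Qed.

Lemma mxtrace_dagger_mul m n (A : 'M[C]_(m, n)) :
  \tr (dagger A *m A) = (\sum_i \sum_j normc (A i j) ^+ 2)%:C.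
Proof.
rewrite exchange_big /= rmorph_sum; apply: eq_bigr => j _.
rewrite mxE rmorph_sum; apply: eq_bigr => i _.
by rewrite daggerE -normCKC normc_normr rmorphXn.
Qed.

Lemma nrm_dagger m n (A : 'M[C]_(m, n)) : nrm (dagger A) = nrm A.
Proof.
rewrite /nrm exchange_big; apply: eq_bigr => i _; apply: eq_bigr => j _.
by apply: complexI; rewrite -!normc_normr daggerE norm_conjC.
Qed.

Definition quadform n (A : 'M[C]_n) (psi : 'cV[C]_n) : C :=
  (dagger psi *m A *m psi) 0 0.

Lemma quadformD n (A B : 'M[C]_n) psi :
  quadform (A + B) psi = quadform A psi + quadform B psi.
Proof. by rewrite /quadform mulmxDr mulmxDl mxE. Qed.

Lemma quadformZ n c (A : 'M[C]_n) psi : quadform (c *: A) psi = c * quadform A psi.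
Proof. by rewrite /quadform -scalemxAr -scalemxAl mxE. Qed.

Lemma quadform1 n (psi : 'cV[C]_n) :
  quadform 1%:M psi = (\sum_i normc (psi i 0) ^+ 2)%:C.
Proof.
rewrite /quadform mulmx1 mxE rmorph_sum; apply: eq_bigr => i _.
by rewrite daggerE -normCKC normc_normr rmorphXn.
Qed.

(** Every product of two moduli of entries of [psi] is bounded by the squared length, because each
    of the two squares is. *)
Lemma normc_quadform_le n (A : 'M[C]_n) (psi : 'cV[C]_n) :
  normc (quadform A psi) <= nrm A * \sum_i normc (psi i 0) ^+ 2.
Proof.
set S := \sum_i _.
have le_S i j : normc (psi i 0) * normc (psi j 0) <= S.
  have le1 k : normc (psi k 0) ^+ 2 <= S.
    rewrite /S (bigD1 k) //= lerDl; apply: sumr_ge0 => l _.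
    by rewrite exprn_ge0 ?normc_ge0.
  have := le1 i; have := le1 j.
  set a := normc (psi i 0); set b := normc (psi j 0) => hb ha.
  have := sqr_ge0 (a - b); nra.
rewrite /quadform -mulmxA mxE; apply: le_trans (ler_normc_sum _ _ _) _.
rewrite /nrm mulr_suml; apply: ler_sum => i _.
rewrite [(A *m psi) i 0]mxE normcM mulr_suml mulrC.
apply: le_trans (ler_wpM2r (normc_ge0 _) (ler_normc_sum _ _ _)) _.
rewrite mulr_suml; apply: ler_sum => j _; rewrite normcM -mulrA.
apply: ler_wpM2l; first exact: normc_ge0.
suff -> : normc (dagger psi 0 i) = normc (psi i 0) by exact: le_S.
by apply: complexI; rewrite -!normc_normr daggerE norm_conjC.
Qed.

(** In the rank factorisation of [P] as a column base times a row base, idempotence cancels to row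
    base times column base equal to 1, whose trace is the rank. Equality of ranks thus becomes
    equality of traces. *)
Lemma mxtrace_idem n (P : 'M[C]_n) : P *m P = P -> \tr P = (\rank P)%:R.
Proof.
move=> idP; rewrite -{1}(mulmx_base P) mxtrace_mulC.
suff -> : row_base P *m col_base P = 1%:M by rewrite mxtrace1.
apply: (row_full_inj (col_base_full P)).
apply: (row_free_inj (row_base_free P)).
by rewrite mulmx1 mulmxA mulmx_base -mulmxA mulmx_base.
Qed.

End Dagger.

Section SpectralProjections.
Variables (R : realType) (n : nat) (H : 'M[R[i]]_n).
Variables (E : 'I_n -> R) (phi : 'I_n -> 'cV[R[i]]_n).
Hypothesis hE : sorted_eigenbasis H E phi.

Let orth i j : dagger (phi i) *m phi j = (i == j)%:R%:M.
Proof. by case: hE. Qed.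

Let eigen i : H *m phi i = (E i)%:C *: phi i.
Proof. by case: hE. Qed.

Lemma eigenbasis_complete : \sum_i phi i *m dagger (phi i) = 1%:M.
Proof.
pose U : 'M[R[i]]_n := \matrix_(a, i) phi i a 0.
have UU : dagger U *m U = 1%:M.
  apply/matrixP=> i j; rewrite mxE.
  have := congr1 (fun A : 'M_1 => A 0 0) (orth i j); rewrite !mxE eqxx /= mulr1n.
  by move=> <-; apply: eq_bigr => a _; rewrite !daggerE !mxE.
rewrite -(mulmx1C UU); apply/matrixP=> a b; rewrite summxE mxE.
by apply: eq_bigr => i _; rewrite mxE big_ord1 !daggerE !mxE.
Qed.

Lemma normc_eigenvector_le1 i a : normc (phi i a 0) <= 1.
Proof.
have : quadform 1%:M (phi i) = 1 by rewrite /quadform mulmx1 orth eqxx mxE.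
rewrite quadform1 => /complexI e1.
rewrite -(@ler_pXn2r _ 2) ?nnegrE ?normc_ge0 // expr1n -e1 (bigD1 a) //= lerDl.
by apply: sumr_ge0 => b _; rewrite exprn_ge0 ?normc_ge0.
Qed.

Lemma nrm_eigenprojection i : nrm (phi i *m dagger (phi i)) <= n%:R * n%:R.
Proof.
rewrite -[X in _ * X]mulr1; apply: nrm_le_entries => a b.
rewrite mxE big_ord1 daggerE normcM -[leRHS]mulr1.
apply: ler_pM; rewrite ?normc_ge0 ?normc_eigenvector_le1 //.
suff -> : normc (Num.conj (phi i b 0)) = normc (phi i b 0).
  exact: normc_eigenvector_le1.
by apply: complexI; rewrite -!normc_normr norm_conjC.
Qed.

(** Expanding [H] over the complete orthonormal eigenbasis turns the right eigenvectors into left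
    ones with the same real eigenvalue. *)
Lemma dagger_eigenvector i : dagger (phi i) *m H = (E i)%:C *: dagger (phi i).
Proof.
rewrite -[H]mulmx1 -eigenbasis_complete mulmx_sumr mulmx_sumr (bigD1 i) //=.
rewrite big1 => [|j ji]; rewrite !mulmxA -(mulmxA _ H) eigen -scalemxAr.
  by rewrite -scalemxAl orth eqxx mul1mx addr0.
by rewrite -scalemxAl orth eq_sym (negbTE ji) mul_scalar_mx scale0r scaler0.
Qed.

Definition eigenprojector (p : pred 'I_n) : 'M[R[i]]_n :=
  \sum_(i < n | p i) phi i *m dagger (phi i).

Lemma dagger_eigenprojector p : dagger (eigenprojector p) = eigenprojector p.
Proof.
by rewrite dagger_sum; apply: eq_bigr => i _; rewrite daggerM daggerK.
Qed.

Lemma eigenprojector_idem p : eigenprojector p *m eigenprojector p = eigenprojector p.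
Proof.
rewrite {1}/eigenprojector mulmx_suml; apply: eq_bigr => i pi.
rewrite mulmx_sumr (bigD1 i) //= big1 => [|j /andP[_ ji]].
  by rewrite addr0 mulmxA -(mulmxA (phi i)) orth eqxx mulmx1.
by rewrite mulmxA -(mulmxA (phi i)) orth eq_sym (negbTE ji) mul_mx_scalar scale0r mul0mx.
Qed.

Lemma eigenprojectorC p : 1%:M - eigenprojector p = eigenprojector (predC p).
Proof.
by rewrite -eigenbasis_complete (bigID p) /= addrAC subrr add0r.
Qed.

(** The bound depends on the dimension only, hence is uniform in the coupling and in the choice of
    eigenbasis. *)
Lemma nrm_eigenprojector p : nrm (eigenprojector p) <= n%:R * (n%:R * n%:R).
Proof.
have le_sum (r : seq 'I_n) (q : pred 'I_n) :
    nrm (\sum_(i <- r | q i) phi i *m dagger (phi i)) <= \sum_(i <- r) n%:R * n%:R.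
  elim: r => [|i r IHr]; first by rewrite !big_nil nrm0.
  rewrite !big_cons; case: ifP => _.
    by apply: le_trans (nrmD _ _) _; rewrite lerD ?nrm_eigenprojection.
  by rewrite -[leLHS]add0r lerD // mulr_ge0.
apply: le_trans (le_sum _ _) _.
by rewrite big_const_ord iter_addr_0 -[X in X <= _]mulr_natl.
Qed.

Lemma eigenprojector_comm p : H *m eigenprojector p = eigenprojector p *m H.
Proof.
rewrite mulmx_sumr mulmx_suml; apply: eq_bigr => i _.
by rewrite mulmxA eigen -mulmxA dagger_eigenvector -scalemxAl -scalemxAr.
Qed.

Lemma mxtrace_eigenprojector p : \tr (eigenprojector p) = #|p|%:R.
Proof.
rewrite raddf_sum /= -sum1_card natr_sum; apply: eq_bigr => i _.
by rewrite mxtrace_mulC orth eqxx mxtrace1.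
Qed.

Lemma sum_eigenvalueE p :
  \sum_(i < n | p i) (E i)%:C *: (phi i *m dagger (phi i)) = H *m eigenprojector p.
Proof.
by rewrite mulmx_sumr; apply: eq_bigr => i _; rewrite mulmxA eigen scalemxAl.
Qed.

(* Courant-Fischer: the first [j+1] eigenvectors span a space too large to
   avoid the kernel of a matrix [P] of rank at most [j]. *)
Lemma eigenvalue_ge_on_kernel (P : 'M[R[i]]_n) (c : R) (j : 'I_n) :
  (\rank P <= j)%N ->
  (forall psi : 'cV_n, P *m psi = 0 ->
     c%:C * quadform 1%:M psi <= quadform H psi) ->
  c <= E j.
Proof.
move=> rkP hP; have ltj : (j < n)%N := ltn_ord j.
pose w (a : 'I_j.+1) : 'I_n := widen_ord ltj a.
have w_inj : injective w by move=> a b /(congr1 val) /= /val_inj.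
pose B : 'M[R[i]]_(j.+1, n) := \matrix_(a, b) phi (w a) b 0.
(* There are [j.+1] rows but the rank is at most [j], so some nonzero combination of the first
   [j.+1] eigenvectors is killed by [P]. *)
have : kermx (B *m P^T) != 0.
  rewrite -mxrank_eq0 mxrank_ker -lt0n subn_gt0 ltnS.
  by apply: leq_trans (mxrankM_maxr _ _) _; rewrite mxrank_tr.
move=> /rowV0Pn[x /sub_kermxP xK x0].
pose psi : 'cV[R[i]]_n := (x *m B)^T.
have psiE : psi = \sum_a x 0 a *: phi (w a).
  apply/matrixP=> b z; rewrite !mxE summxE; apply: eq_bigr => a _.
  by rewrite !mxE (ord1 z).
have Ppsi : P *m psi = 0.
  by apply: trmx_inj; rewrite trmx_mul trmxK -mulmxA xK trmx0.
have coef (F : 'I_n -> R[i]) (A : 'M_n) : (forall i, A *m phi i = F i *: phi i) ->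
    quadform A psi = \sum_a F (w a) * `|x 0 a| ^+ 2.
  move=> hA; rewrite /quadform -mulmxA psiE dagger_sum mulmx_suml summxE.
  apply: eq_bigr => a _; rewrite daggerZ mulmx_sumr mulmx_sumr (bigD1 a) //=.
  rewrite big1 ?addr0 => [|b ba]; rewrite -scalemxAr hA -scalemxAl -!scalemxAr orth.
    by rewrite eqxx !mxE mulr1 normCK; ring.
  by rewrite (inj_eq w_inj) eq_sym (negbTE ba)
    !(scale_scalar_mx, mulr0) raddf0.
have := hP psi Ppsi; rewrite (coef (fun i => (E i)%:C) H) //.
rewrite (coef (fun _ => 1) 1%:M) => [|i]; last by rewrite mul1mx scale1r.
under eq_bigr do rewrite mul1r.
move=> le1.
have S0 : 0 < \sum_a `|x 0 a| ^+ 2.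
  have [a xa] : exists a, x 0 a != 0.
    apply/existsP; apply: contra_neqT x0 => /existsPn x0.
    by apply/rowP=> a; rewrite mxE; apply/eqP; have := x0 a; rewrite negbK.
  rewrite (bigD1 a) //= ltr_pwDl ?exprn_gt0 ?normr_gt0 //.
  by apply: sumr_ge0 => b _; rewrite exprn_ge0.
have : c%:C * \sum_a `|x 0 a| ^+ 2 <= (E j)%:C * \sum_a `|x 0 a| ^+ 2.
  apply: le_trans le1 _; rewrite mulr_sumr; apply: ler_sum => a _.
  rewrite ler_wpM2r ?exprn_ge0 // lecR; case: hE => _ _; apply.
  by rewrite /= -ltnS.
by rewrite ler_pM2r // lecR.
Qed.

End SpectralProjections.

(** * From an approximate invariant subspace to the effective Hamiltonian *)

Section Perturbation.
Variables (R : realType) (n : nat) (D V P T : 'M[R[i]]_n) (E0 : R).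
Hypothesis daggerV : dagger V = V.
Hypothesis daggerP : dagger P = P.
Hypothesis idemP : P *m P = P.
Hypothesis gapD : forall psi, P *m psi = 0 -> quadform 1%:M psi <= quadform D psi.

Section GroundSpace.
Hypothesis daggerD : dagger D = D.
Hypothesis DP0 : D *m P = 0.

Let PD0 : P *m D = 0.
Proof. by rewrite -[LHS]daggerK daggerM daggerD daggerP DP0 dagger0. Qed.

Lemma quadform1_gt0 (psi : 'cV[R[i]]_n) : psi != 0 -> 0 < quadform 1%:M psi.
Proof.
move=> psi0; rewrite quadform1 ltcR.
have [a xa] : exists a, psi a 0 != 0.
  apply/existsP; apply: contra_neqT psi0 => /existsPn psi0.
  by apply/colP=> a; rewrite mxE; apply/eqP; have := psi0 a; rewrite negbK.
rewrite (bigD1 a) //= ltr_pwDl //; last first.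
  by apply: sumr_ge0 => b _; rewrite exprn_ge0 ?normc_ge0.
by rewrite exprn_gt0 // -ltcR -normc_normr normr_gt0.
Qed.

Lemma quadform_dagger (A : 'M[R[i]]_n) (u : 'rV[R[i]]_n) :
  quadform A (dagger u) = (u *m A *m dagger u) 0 0.
Proof. by rewrite /quadform daggerK. Qed.

(** The effective Hamiltonian takes its number of levels from the eigenspace of the unperturbed
    operator; this identifies that number with [\rank P]. Eigenspaces consist of row vectors, whence
    the use of [P *m D = 0] and of daggers. *)
Lemma ground_space (e : R) : P != 0 -> ground_energy (D + E0%:C%:M) e ->
  e = E0 /\ \rank (eigenspace (D + E0%:C%:M) e%:C) = \rank P.
Proof.
move=> P0 [/eigenvalueP[u uH u0] emin].
have e_le : e <= E0.
  apply: emin; have /rowV0Pn[v /submxP[w vE] v0] := P0; apply/eigenvalueP.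
  by exists v => //; rewrite mulmxDr vE -mulmxA PD0 mulmx0 add0r mul_mx_scalar.
have uD : u *m D = (e - E0)%:C *: u.
  apply: (addIr (u *m E0%:C%:M)); rewrite -mulmxDr uH mul_mx_scalar -scalerDl.
  by rewrite -rmorphD subrK.
(* If [e] differs from [E0], then [u] is orthogonal to [P] and the gap forces [e >= E0 + 1], against
   [e <= E0]. *)
have e_eq : e = E0.
  apply/eqP; apply: contraTT e_le => ne; rewrite -ltNge.
  have uP : u *m P = 0.
    have : (e - E0)%:C *: (u *m P) = 0 by rewrite scalemxAl -uD -mulmxA DP0 mulmx0.
    move/eqP; rewrite scaler_eq0 => /orP[|/eqP//].
    by rewrite -[0]/(0%:C) (inj_eq (@complexI R)) subr_eq0 (negbTE ne).
  have Pu : P *m dagger u = 0 by rewrite -[P]daggerP -daggerM uP dagger0.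
  have := gapD Pu; rewrite [leRHS]quadform_dagger uD -scalemxAl mxE.
  rewrite -{2}[u]mulmx1 -quadform_dagger.
  have : 0 < quadform 1%:M (dagger u).
    apply: quadform1_gt0; apply: contra_neq u0 => du.
    by rewrite -[u]daggerK du dagger0.
  rewrite quadform1; set S := \sum_i _; rewrite ltcR -rmorphM lecR => S0 le1.
  nra.
split=> //; rewrite {}e_eq.
apply: eqmx_rank; apply/andP; split; last first.
  apply/eigenspaceP; rewrite mulmxDr PD0 add0r mul_mx_scalar //.
apply/rV_subP => v /eigenspaceP vH; have {vH}vD : v *m D = 0.
  apply: (addIr (v *m E0%:C%:M)); rewrite -mulmxDr vH mul_mx_scalar add0r //.
suff -> : v = v *m P by exact: submxMl.
(* The part of [v] outside [P] is annihilated by [D], so the gap leaves it no length. *)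
pose w := v - v *m P.
have wP : w *m P = 0 by rewrite mulmxBl -mulmxA idemP subrr.
have Pw : P *m dagger w = 0 by rewrite -[P]daggerP -daggerM wP dagger0.
have wD : w *m D = 0 by rewrite mulmxBl -mulmxA PD0 vD mulmx0 subrr.
apply/eqP; rewrite -subr_eq0; apply: contraTT (gapD Pw) => w0.
rewrite [in X in _ <= X]quadform_dagger wD mul0mx [in X in _ <= X]mxE.
rewrite lt_geF //; apply: quadform1_gt0; apply: contra_neq w0 => dw.
by rewrite -[LHS]daggerK dw dagger0.
Qed.

End GroundSpace.

Variables (W : nat -> 'M[R[i]]_n) (g : nat -> R).
Hypothesis W0 : W 0%N = P.
Hypothesis recW : forall k, (k < 7)%N ->
  D *m W k + (if k is k'.+1 then V *m W k' else 0) =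
  \sum_(i < 6) \sum_(j < 7 | (i.+1 + j == k)%N) (g i)%:C *: W j
    + (if k == 6 then T else 0).
Hypothesis PTP : P *m T *m P = T.

(** This is the function [f] of the theorem, the common energy of the ground multiplet before [T]
    splits it. *)
Definition energy_shift (l : R) : R := E0 + \sum_(i < 6) l ^+ i.+1 * g i.

Let I : Type := (R * ('I_n -> R) * ('I_n -> 'cV[R[i]]_n))%type.
Let lam (i : I) : R := i.1.1.
Let H (i : I) := D + E0%:C%:M + (lam i)%:C *: V.
Let good (i : I) : Prop := sorted_eigenbasis (H i) i.1.2 i.2.
Let K (i : I) := H i - (energy_shift (lam i))%:C%:M.
Let Wl (i : I) := \sum_(j < 7) (lam i ^+ j)%:C *: W j.
Let Pi (i : I) := eigenprojector i.2 (fun j => (j < \rank P)%N).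

Local Notation O := (bigO good lam).

(** [recW] equates the coefficients of [(H - f) W = l^6 T] up to order 6. What survives is
    [V *m W 6] and the products of a shift coefficient with a [W j] of combined order at least 7. *)
Let residual : O 7 (fun i => K i *m Wl i - (lam i ^+ 6)%:C *: T).
Proof.
have E (i : I) : K i *m Wl i - (lam i ^+ 6)%:C *: T =
    (lam i ^+ 7)%:C *: (V *m W 6)
    - \sum_(a < 6) \sum_(j < 7 | (7 <= a.+1 + j)%N)
        (lam i ^+ (a.+1 + j))%:C *: ((g a)%:C *: W j).
  set l := lam i.
  have KE : K i = D + l%:C *: V - \sum_(a < 6) (l ^+ a.+1 * g a)%:C%:M.
    have shiftE : (energy_shift l)%:C%:M = E0%:C%:M
        + \sum_(a < 6) (l ^+ a.+1 * g a)%:C%:M :> 'M[R[i]]_n.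
      by rewrite rmorphD raddfD /= rmorph_sum raddf_sum.
    by rewrite /K /H -/l shiftE [X in X - _]addrAC addrKA.
  have sum_rec : \sum_(k < 7) (l ^+ k)%:C *: (D *m W k) +
      \sum_(k < 6) (l ^+ k.+1)%:C *: (V *m W k) =
      \sum_(a < 6) \sum_(j < 7 | (a.+1 + j < 7)%N)
        (l ^+ (a.+1 + j))%:C *: ((g a)%:C *: W j) + (l ^+ 6)%:C *: T.
    transitivity (\sum_(k < 7) (l ^+ k)%:C *:
        (D *m W k + (if (k : nat) is k'.+1 then V *m W k' else 0))).
      under [RHS]eq_bigr do rewrite scalerDr.
      rewrite big_split; congr (_ + _); rewrite [RHS]big_ord_recl /= scaler0 add0r.
      by [].
    under eq_bigr => k _ do rewrite recW // scalerDr.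
    rewrite big_split /=; congr (_ + _); last first.
      by rewrite big_ord_recr /= big1 ?add0r // => k _; rewrite ltn_eqF ?scaler0.
    under eq_bigr => k _ do rewrite scaler_sumr.
    rewrite exchange_big; apply: eq_bigr => a _ /=.
    under eq_bigr => k _ do (rewrite scaler_sumr big_mkcond /=).
    rewrite exchange_big [RHS]big_mkcond; apply: eq_bigr => j _ /=.
    case: ifP => [lt7|ge7].
      rewrite (bigD1 (Ordinal lt7)) //= eqxx big1 ?addr0 // => k.
      by rewrite -val_eqE /= eq_sym => /negbTE ->.
    by rewrite big1 // => k _; case: eqP => // kE; rewrite kE ltn_ord in ge7.
  rewrite KE mulmxBl mulmxDl.
  have -> : D *m Wl i = \sum_(k < 7) (l ^+ k)%:C *: (D *m W k).
    by rewrite mulmx_sumr; apply: eq_bigr => k _; rewrite scalemxAr.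
  have -> : l%:C *: V *m Wl i =
      \sum_(k < 6) (l ^+ k.+1)%:C *: (V *m W k) + (l ^+ 7)%:C *: (V *m W 6).
    rewrite mulmx_sumr big_ord_recr /=; congr (_ + _).
      apply: eq_bigr => k _.
      by rewrite -scalemxAl -scalemxAr scalerA -rmorphM exprS.
    by rewrite -scalemxAl -scalemxAr scalerA -rmorphM exprS.
  have -> : (\sum_(a < 6) (l ^+ a.+1 * g a)%:C%:M) *m Wl i =
      \sum_(a < 6) \sum_(j < 7 | (a.+1 + j < 7)%N)
        (l ^+ (a.+1 + j))%:C *: ((g a)%:C *: W j)
      + \sum_(a < 6) \sum_(j < 7 | (7 <= a.+1 + j)%N)
        (l ^+ (a.+1 + j))%:C *: ((g a)%:C *: W j).
    rewrite mulmx_suml -big_split; apply: eq_bigr => a _ /=.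
    rewrite /Wl -/l mul_scalar_mx scaler_sumr.
    have term (j : 'I_7) : (l ^+ a.+1 * g a)%:C *: ((l ^+ j)%:C *: W j) =
        (l ^+ (a.+1 + j))%:C *: ((g a)%:C *: W j).
      by rewrite !scalerA -!rmorphM exprD mulrAC.
    rewrite (eq_bigr _ (fun j _ => term j)).
    rewrite (bigID (fun j : 'I_7 => (a.+1 + j < 7)%N)) /=.
    by under [X in _ + X = _]eq_bigl => j do rewrite -leqNgt.
  rewrite addrA sum_rec.
  set A := \sum_(a < 6) _; set B := \sum_(a < 6) _; set C := _ *: T; set G := _ *: _.
  clearbody A B C G.
  by apply/matrixP => x y; rewrite !mxE; ring.
apply: bigO_ext => [i _|]; first by rewrite E.
apply: bigO_B; first exact: (bigO_powZ 7 (bigO_const _ _ _)).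
apply: bigO_sum => a _; apply: bigO_sum => j le7.
by apply: bigO_le le7 _; rewrite -[X in O X]addn0; apply: bigO_powZ (bigO_const _ _ _).
Qed.

Let Pi_bounded : O 0 Pi.
Proof.
apply: (@bigO_bounded _ _ _ _ _ _ (n%:R * (n%:R * n%:R))) => i gi.
exact: nrm_eigenprojector gi _.
Qed.

Let K_comm i : good i -> K i *m Pi i = Pi i *m K i.
Proof.
move=> gi; rewrite /K mulmxBl mulmxBr (eigenprojector_comm gi).
by rewrite mul_scalar_mx mul_mx_scalar.
Qed.

Let Pi_idem i : good i -> Pi i *m Pi i = Pi i.
Proof. by move=> gi; apply: eigenprojector_idem gi _. Qed.

Let Wl_P : O 1 (fun i => Wl i - P).
Proof.
apply: (@bigO_ext _ _ _ _ _ _ _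
  (fun i => \sum_(j < 6) (lam i ^+ j.+1)%:C *: W j.+1)) => [i _|].
  by rewrite /Wl [in RHS]big_ord_recl /= expr0 scale1r W0 addrC addKr.
apply: bigO_sum => j _; apply: (@bigO_le _ _ _ _ _ _ _ (j.+1 + 0)) => //.
exact: bigO_powZ (bigO_const _ _ _).
Qed.

Let KW_small : O 6 (fun i => K i *m Wl i).
Proof.
apply: bigO_ext (bigO_D (bigO_le _ residual) (bigO_powZ 6 (bigO_const good lam T))) => //.
by move=> i _; rewrite subrK.
Qed.

(** On the kernel of [P] the quadratic form of [H] is at least [E0 + 1 - |l| * nrm V], and
    Courant-Fischer passes this to every eigenvalue of index at least [\rank P]. *)
Let spectral_gap : exists2 d : R, 0 < d & forall i, good i -> `|lam i| < d ->
  forall j : 'I_n, (\rank P <= j)%N -> 1 / 2 <= i.1.2 j - energy_shift (lam i).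
Proof.
pose B := nrm V + \sum_(a < 6) `|g a|.
have G0 : 0 <= \sum_(a < 6) `|g a| by apply: sumr_ge0.
have B0 : 0 <= B by rewrite addr_ge0 ?nrm_ge0.
have B2 : 0 < 2 * (B + 1) by rewrite mulr_gt0 // ltr_wpDl.
(* [B] bounds the combined motion, per unit of [|l|], of the upper levels and of the shift; with
   this threshold half of the unit gap remains. [|l| < 1] bounds the higher powers in the shift by
   [|l|]. *)
exists (Num.min 1 (1 / (2 * (B + 1)))); first by rewrite lt_min ltr01 divr_gt0.
move=> i gi; rewrite lt_min => /andP[l1]; rewrite ltr_pdivlMr // => lB j rj.
set l := lam i in l1 lB *.
have shift_le : energy_shift l - E0 <= `|l| * \sum_(a < 6) `|g a|.
  rewrite /energy_shift addrAC subrr add0r mulr_sumr; apply: ler_sum => a _.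
  apply: le_trans (ler_norm _) _; rewrite normrM normrX ler_wpM2r //.
  by rewrite exprS ler_piMr // exprn_ile1 // ltW.
have := @eigenvalue_ge_on_kernel _ _ _ _ _ gi P (E0 + 1 - `|l| * nrm V) j rj.
have herm_part (psi : 'cV_n) : P *m psi = 0 ->
    (E0 + 1 - `|l| * nrm V)%:C * quadform 1%:M psi <= quadform (H i) psi.
  move=> /gapD; rewrite /H !quadformD -[E0%:C%:M]scalemx1 !quadformZ quadform1.
  have := normc_quadform_le V psi; set S := \sum_a _ => le_VS leD.
  have [r rE] : exists r : R, quadform V psi = r%:C.
    apply/complex_realP; rewrite CrealE; apply/eqP.
    rewrite /quadform -daggerE; congr (_ _ 0 0).
    by rewrite !daggerM daggerK daggerV mulmxA.
  rewrite rE normc_real in le_VS; rewrite rE -!rmorphM -[leRHS]addrA -rmorphD.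
  apply: le_trans (lerD leD (lexx _)); rewrite -rmorphD lecR.
  have lr : - (`|l| * (nrm V * S)) <= l * r.
    rewrite lerNl; apply: le_trans (ler_norm _) _; rewrite normrN normrM.
    by rewrite ler_wpM2l.
  rewrite -/l; nra.
move=> /(_ herm_part); rewrite -/l => ge_E.
have lB' : `|l| * B <= 1 / 2 by have := normr_ge0 l; nra.
rewrite /B mulrDr in lB'; lra.
Qed.

(** On an eigenvector above the gap [K] is a number at least 1/2. Dividing by it expresses each
    component of [Wl] there through the same component of [K *m Wl], with a loss of at most a factor
    2. *)
Let PiC_Wl : O 6 (fun i => (1%:M - Pi i) *m Wl i).
Proof.
have [d d0 gap] := spectral_gap; have [C [d' [C0 d'0 le_KW]]] := KW_small.
exists (n%:R * (2 * (n%:R * n%:R) * C)), (Num.min d d').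
split=> [||i gi]; first by rewrite !mulr_ge0.
  by rewrite lt_min d0.
rewrite lt_min => /andP[ld ld']; have {}le_KW := le_KW i gi ld'.
have {}gap := gap i gi ld; rewrite (eigenprojectorC gi) mulmx_suml.
have term_le (j : 'I_n) : (\rank P <= j)%N ->
    nrm (i.2 j *m dagger (i.2 j) *m Wl i) <=
    2 * (n%:R * n%:R) * C * `|lam i| ^+ 6.
  move=> /gap gap_j; have gap_gt0 : 0 < i.1.2 j - energy_shift (lam i) by lra.
  have gap0 := lt0r_neq0 gap_gt0.
  have -> : i.2 j *m dagger (i.2 j) *m Wl i =
      ((i.1.2 j - energy_shift (lam i))^-1)%:C *:
        (i.2 j *m dagger (i.2 j) *m (K i *m Wl i)).
    rewrite [in RHS]mulmxA -(mulmxA (i.2 j) _ (K i)) /K mulmxBr (dagger_eigenvector gi).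
    rewrite mul_mx_scalar -scalerBl -rmorphB -scalemxAr -scalemxAl scalerA.
    by rewrite -rmorphM mulVf // scale1r.
  rewrite nrmZ normc_real normfV.
  have inv_le : `|i.1.2 j - energy_shift (lam i)|^-1 <= 2.
    by rewrite gtr0_norm // -[leRHS]invrK lef_pV2 ?posrE ?invr_gt0 // -div1r.
  rewrite -!mulrA; apply: ler_pM; rewrite ?invr_ge0 ?nrm_ge0 //.
  apply: le_trans (nrmM _ _) _; rewrite [leRHS]mulrA.
  by rewrite ler_pM ?nrm_ge0 ?(nrm_eigenprojection gi).
have sum_le (r : seq 'I_n) (p : pred 'I_n) : (forall j, p j -> (\rank P <= j)%N) ->
    nrm (\sum_(j <- r | p j) i.2 j *m dagger (i.2 j) *m Wl i) <=
    \sum_(j <- r) 2 * (n%:R * n%:R) * C * `|lam i| ^+ 6.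
  move=> hp; elim: r => [|j r IHr]; first by rewrite !big_nil nrm0.
  rewrite !big_cons; case: ifP => [/hp/term_le le_j|_].
    by apply: le_trans (nrmD _ _) _; rewrite lerD.
  by rewrite -[leLHS]add0r lerD // !mulr_ge0 ?exprn_ge0.
apply: le_trans (sum_le _ _ _) _ => [j /=|]; first by move=> h; rewrite leqNgt.
by rewrite big_const_ord iter_addr_0 -[X in X <= _]mulr_natl mulrA.
Qed.

Let PiC_P : O 1 (fun i => (1%:M - Pi i) *m P).
Proof.
have PiC0 : O 0 (fun i => 1%:M - Pi i) by apply: bigO_B Pi_bounded; exact: bigO_const.
apply: bigO_ext (bigO_B (bigO_le _ PiC_Wl) (bigO_M PiC0 Wl_P)) => // i _.
by rewrite mulmxBr subKr.
Qed.

(* Orthogonal projections [P], [Q] of equal rank satisfy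
   [tr P(1-Q)P = tr Q(1-P)Q], so [(1-Q)P] and [(1-P)Q] have the same
   Hilbert-Schmidt norm. *)
Lemma nrm_complement_le (Q : 'M[R[i]]_n) :
  dagger Q = Q -> Q *m Q = Q -> \tr Q = \tr P ->
  nrm ((1%:M - P) *m Q) <= n%:R * (n%:R * nrm ((1%:M - Q) *m P)).
Proof.
move=> dQ iQ trQ.
have trE (A B : 'M[R[i]]_n) : dagger A = A -> A *m A = A -> dagger B = B ->
    B *m B = B ->
    \tr (dagger ((1%:M - A) *m B) *m ((1%:M - A) *m B)) = \tr B - \tr (A *m B).
  move=> dA iA dB iB.
  have dAC : dagger (1%:M - A) = 1%:M - A by rewrite daggerD daggerN dagger1 dA.
  have iAC : (1%:M - A) *m (1%:M - A) = 1%:M - A.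
    by rewrite mulmxBr mulmx1 mulmxBl mul1mx iA subrr subr0.
  rewrite daggerM dB dAC -mulmxA mxtrace_mulC -!mulmxA iB mulmxA iAC.
  by rewrite mulmxBl mul1mx raddfB.
have : \tr (dagger ((1%:M - P) *m Q) *m ((1%:M - P) *m Q)) =
       \tr (dagger ((1%:M - Q) *m P) *m ((1%:M - Q) *m P)).
  by rewrite !trE // trQ (mxtrace_mulC P).
rewrite !mxtrace_dagger_mul => /complexI eq_fro.
apply: nrm_le_entries => a b.
rewrite -(@ler_pXn2r _ 2) ?nnegrE ?normc_ge0 ?nrm_ge0 //.
apply: (@le_trans _ _ (\sum_i \sum_j normc (((1%:M - P) *m Q) i j) ^+ 2)).
  rewrite (bigD1 a) //= (bigD1 b) //= -addrA lerDl addr_ge0 //.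
    by apply: sumr_ge0 => j _; rewrite exprn_ge0 ?normc_ge0.
  by do 2!apply: sumr_ge0 => ? _; rewrite exprn_ge0 ?normc_ge0.
rewrite eq_fro expr2 {1}/nrm mulr_suml; apply: ler_sum => i _.
rewrite mulr_suml; apply: ler_sum => j _; rewrite expr2.
by rewrite ler_wpM2l ?normc_ge0 ?normc_le_nrm.
Qed.

Let PC_Pi : O 1 (fun i => (1%:M - P) *m Pi i).
Proof.
have [C [d [C0 d0 le_C]]] := PiC_P.
exists (n%:R * (n%:R * C)), d; split=> // [|i gi ld]; first by rewrite !mulr_ge0.
(* [Pi] has exactly [\rank P] orthonormal eigenvectors, because the rank does not exceed the
   dimension. *)
have trPi : \tr (Pi i) = \tr P.
  rewrite (mxtrace_eigenprojector gi) mxtrace_idem //; congr (_%:R).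
  by rewrite -sum1_card (big_ord_narrow (rank_leq_row P)) sum1_card card_ord.
apply: le_trans (nrm_complement_le (dagger_eigenprojector _ _) _ trPi) _.
  exact: Pi_idem.
by rewrite -!mulrA !ler_wpM2l // le_C.
Qed.


Let P_PiC : O 1 (fun i => P *m (1%:M - Pi i)).
Proof.
have [C [d [C0 d0 le_C]]] := PiC_P; exists C, d; split=> // i gi ld.
apply: le_trans (le_C i gi ld); rewrite -[leRHS]nrm_dagger daggerM daggerP.
by rewrite daggerD daggerN dagger1 dagger_eigenprojector.
Qed.

Let Pi_P : O 1 (fun i => Pi i - P).
Proof.
apply: bigO_ext (bigO_B PC_Pi P_PiC) => i _.
by rewrite mulmxBl mulmxBr mul1mx mulmx1 opprB addrA subrK.
Qed.

(** The unknown [A *m Q] reappears on the right, multiplied by a factor that is small when [B] is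
    close to [Q]; this is the shape that [bigO_absorb] consumes. *)
Lemma compress_commuting (A Q B : 'M[R[i]]_n) : A *m Q = Q *m A -> Q *m Q = Q ->
  A *m Q = Q *m (A *m B) *m Q + A *m Q *m (Q *m (Q - B) *m Q).
Proof.
move=> AQ QQ; rewrite mulmxBr mulmxBl !QQ mulmxBr !mulmxA -AQ.
by rewrite -!(mulmxA A) QQ addrC subrK.
Qed.

Let KPi_rec i : good i ->
  K i *m Pi i = Pi i *m (K i *m Wl i) *m Pi i +
    K i *m Pi i *m (Pi i *m (Pi i - Wl i) *m Pi i).
Proof. by move=> gi; apply: compress_commuting; [exact: K_comm | exact: Pi_idem]. Qed.

Let PiPiW : O 1 (fun i => Pi i *m (Pi i - Wl i) *m Pi i).
Proof.
have PiW : O 1 (fun i => Pi i - Wl i).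
  by apply: bigO_ext (bigO_B Pi_P Wl_P) => i _; rewrite opprB addrA subrK.
exact: bigO_M (bigO_M Pi_bounded PiW) Pi_bounded.
Qed.

Let KPi_small : O 6 (fun i => K i *m Pi i).
Proof.
exact: bigO_absorb (bigO_M (bigO_M Pi_bounded KW_small) Pi_bounded) PiPiW KPi_rec.
Qed.

(** In [KPi_rec] the last term is now [O(6)] times [O(1)], and the first is [l^6 Pi T Pi] up to
    order 7. Replacing [Pi] by [P] there costs one more order, and [PTP] removes [P]. *)
Let KPi_leading : O 7 (fun i => K i *m Pi i - (lam i ^+ 6)%:C *: T).
Proof.
have PiTPi : O 1 (fun i => Pi i *m T *m Pi i - T).
  have OT := bigO_const good lam T; have OP := bigO_const good lam P.
  apply: bigO_ext (bigO_D (bigO_M (bigO_M Pi_P OT) Pi_bounded)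
    (bigO_M (bigO_M OP OT) Pi_P)) => i _.
  by rewrite !mulmxBl !mulmxBr PTP addrA subrK.
apply: bigO_ext (bigO_D (bigO_D (bigO_M (bigO_M Pi_bounded residual) Pi_bounded)
  (bigO_M KPi_small PiPiW)) (bigO_powZ 6 PiTPi)) => i gi.
rewrite [in RHS]KPi_rec //; set Z := K i *m Pi i *m _.
rewrite mulmxBr mulmxBl scalerBr -scalemxAr -scalemxAl.
by rewrite addrA; congr (_ - _); rewrite addrAC subrK.
Qed.

Lemma effective_hamiltonian_expansion :
  exists (C l0 : R), 0 < l0 /\
    forall l : R, `|l| < l0 -> forall E phi,
    sorted_eigenbasis (D + E0%:C%:M + l%:C *: V) E phi ->
    opnorm_le
      (\sum_(i < n | (i < \rank P)%N) (E i)%:C *: (phi i *m dagger (phi i))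
       - (energy_shift l)%:C *:
           (\sum_(i < n | (i < \rank P)%N) phi i *m dagger (phi i))
       - (l ^+ 6)%:C *: T) (C * `|l| ^+ 7).
Proof.
have [C [d [C0 d0 le_C]]] := KPi_leading; exists C, d; split=> // l ld E phi gi.
apply: opnorm_le_nrm; rewrite (sum_eigenvalueE gi).
have := le_C (l, E, phi) gi ld; rewrite /K mulmxBl mul_scalar_mx.
by [].
Qed.

End Perturbation.

(** * Local operators in the product basis *)

Definition upd (T : finType) (V : Type) (x : {ffun T -> V}) (s : T) (g : V) :
  {ffun T -> V} := [ffun t => if t == s then g else x t].

Section Upd.
Variables (T : finType) (V : eqType).
Implicit Types (x : {ffun T -> V}) (s t : T) (g h : V).

Lemma updE x s g t : upd x s g t = if t == s then g else x t.
Proof. by rewrite ffunE. Qed.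

Lemma upd_eq x s g : upd x s g s = g.
Proof. by rewrite updE eqxx. Qed.

Lemma upd_neq x s g t : t != s -> upd x s g t = x t.
Proof. by rewrite updE => /negbTE ->. Qed.

Lemma upd_id x s : upd x s (x s) = x.
Proof. by apply/ffunP=> t; rewrite updE; case: eqP => // ->. Qed.

Lemma upd_upd x s g h : upd (upd x s g) s h = upd x s h.
Proof. by apply/ffunP=> t; rewrite !updE; case: eqP. Qed.

Lemma updC x s t g h : s != t -> upd (upd x s g) t h = upd (upd x t h) s g.
Proof.
move=> st; apply/ffunP=> r; rewrite !updE.
by case: (eqVneq r t) => // ->; rewrite eq_sym (negbTE st).
Qed.

Lemma upd_agreeP x (y : {ffun T -> V}) s :
  reflect (y = upd x s (y s)) [forall t, (t != s) ==> (y t == x t)].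
Proof.
apply: (iffP forallP) => [agree|-> t].
  apply/ffunP=> t; rewrite updE; case: eqVneq => [->//|ts].
  by have := agree t; rewrite ts => /eqP.
by apply/implyP => ts; rewrite upd_neq.
Qed.
End Upd.

Section Kets.
Variables (R : realType) (T : finType).
Local Notation C := R[i].
Implicit Types (c : T) (A B : 'M[C]_#|T|).

Definition ket c : 'cV[C]_#|T| := delta_mx (enum_rank c) 0.

Lemma ketE c c' : ket c (enum_rank c') 0 = (c' == c)%:R.
Proof. by rewrite mxE (inj_eq enum_rank_inj) andbT. Qed.

Lemma mx_ketE A c i : (A *m ket c) i 0 = A i (enum_rank c).
Proof. by rewrite -colE mxE. Qed.

Lemma mulr_ket A B c : (A * B) *m ket c = A *m (B *m ket c).
Proof. by rewrite mulmxA. Qed.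

Lemma mx_ket_ext A B : (forall c, A *m ket c = B *m ket c) -> A = B.
Proof.
move=> eqAB; apply/matrixP=> i j; rewrite -[j]enum_valK.
by rewrite -[LHS]mx_ketE eqAB mx_ketE.
Qed.

Lemma ket_ext (v w : 'cV[C]_#|T|) :
  (forall c, v (enum_rank c) 0 = w (enum_rank c) 0) -> v = w.
Proof. by move=> vw; apply/colP=> a; rewrite -[a]enum_valK vw. Qed.

Definition mxket (f : T -> 'cV[C]_#|T|) : 'M[C]_#|T| :=
  \matrix_(i, j) f (enum_val j) i 0.

Lemma mxketE f c : mxket f *m ket c = f c.
Proof. by apply/colP=> i; rewrite mx_ketE mxE enum_rankK. Qed.

Lemma dagger_ketbra (a b : T) : dagger (ketbra R a b) = ketbra R b a.
Proof. by apply/matrixP=> i j; rewrite daggerE !mxE andbC rmorph_nat. Qed.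

Lemma ketbraE (a b a' b' : T) :
  ketbra R a b (enum_rank a') (enum_rank b') = ((a' == a) && (b' == b))%:R.
Proof. by rewrite mxE !(inj_eq enum_rank_inj). Qed.

End Kets.

Section LocalOperators.
Variables (R : realType) (G : finGroupType) (E : finType) (rot : {perm dart E}).
Local Notation C := R[i].
Local Notation X := {ffun gsite rot -> G}.
Local Notation F := {ffun isite rot -> 'I_6}.
Local Notation Cfg := (config G rot).
Local Notation Op := 'Op[R]_Cfg.
Local Notation ket := (@ket R Cfg).
Implicit Types (x : X) (i : F).

Lemma atG_ket s (A : 'Op[R]_G) x i :
  atG s A *m ket (x, i) =
  \sum_g A (enum_rank g) (enum_rank (x s)) *: ket (upd x s g, i).
Proof.
apply: ket_ext => -[y j]; rewrite mx_ketE mxE !enum_rankK summxE /=.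
under eq_bigr => g _ do rewrite mxE ketE.
case: ifP => [/andP[/upd_agreeP yE /eqP ->]|/negbT ne].
  rewrite (bigD1 (y s)) //= -yE eqxx mulr1 big1 ?addr0 // => g gy.
  by case: eqP => [[e]|_]; rewrite ?mulr0 //; rewrite e upd_eq eqxx in gy.
rewrite big1 // => g _; case: eqP => [[yE ij]|_]; rewrite ?mulr0 //.
case/negP: ne; rewrite ij eqxx andbT; apply/upd_agreeP.
by rewrite yE upd_eq.
Qed.

Lemma atI_ket s (A : 'Op[R]_'I_6) x i :
  atI G s A *m ket (x, i) =
  \sum_k A (enum_rank k) (enum_rank (i s)) *: ket (x, upd i s k).
Proof.
apply: ket_ext => -[y j]; rewrite mx_ketE mxE !enum_rankK summxE /=.
under eq_bigr => g _ do rewrite mxE ketE.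
case: ifP => [/andP[/eqP -> /upd_agreeP jE]|/negbT ne].
  rewrite (bigD1 (j s)) //= -jE eqxx mulr1 big1 ?addr0 // => g gj.
  by case: eqP => [[e]|_]; rewrite ?mulr0 //; rewrite e upd_eq eqxx in gj.
rewrite big1 // => g _; case: eqP => [[yx jE]|_]; rewrite ?mulr0 //.
case/negP: ne; rewrite yx eqxx; apply/upd_agreeP.
by rewrite jE upd_eq.
Qed.

Lemma atG_ketbra_ket s a b x i :
  atG s (ketbra R a b) *m ket (x, i) =
  if x s == b then ket (upd x s a, i) else 0.
Proof.
rewrite atG_ket (bigD1 a) //= ketbraE eqxx /= big1 ?addr0 => [|g ga].
  by case: eqP => _; rewrite ?scale1r ?scale0r.
by rewrite ketbraE (negbTE ga) scale0r.
Qed.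

Lemma atI_ketbra_ket s a b x i :
  atI G s (ketbra R a b) *m ket (x, i) =
  if i s == b then ket (x, upd i s a) else 0.
Proof.
rewrite atI_ket (bigD1 a) //= ketbraE eqxx /= big1 ?addr0 => [|g ga].
  by case: eqP => _; rewrite ?scale1r ?scale0r.
by rewrite ketbraE (negbTE ga) scale0r.
Qed.

Lemma dagger_atG (s : gsite rot) (A : 'Op[R]_G) : dagger (atG s A) = atG s (dagger A).
Proof.
apply/matrixP=> i j; rewrite daggerE !mxE /= (eq_sym (enum_val j).2).
have -> : [forall t, (t != s) ==> ((enum_val j).1 t == (enum_val i).1 t)] =
          [forall t, (t != s) ==> ((enum_val i).1 t == (enum_val j).1 t)].
  by apply: eq_forallb => t; rewrite [X in _ ==> X]eq_sym.
by case: ifP => _; rewrite ?rmorph0 // !mxE.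
Qed.

Lemma dagger_atI (s : isite rot) (A : 'Op[R]_'I_6) :
  dagger (atI G s A) = atI G s (dagger A).
Proof.
apply/matrixP=> i j; rewrite daggerE !mxE /= (eq_sym (enum_val j).1).
have -> : [forall t, (t != s) ==> ((enum_val j).2 t == (enum_val i).2 t)] =
          [forall t, (t != s) ==> ((enum_val i).2 t == (enum_val j).2 t)].
  by apply: eq_forallb => t; rewrite [X in _ ==> X]eq_sym.
by case: ifP => _; rewrite ?rmorph0 // !mxE.
Qed.

Lemma atG_sum (s : gsite rot) (I : Type) (r : seq I) (p : pred I) (A : I -> 'Op[R]_G) :
  atG s (\sum_(k <- r | p k) A k) = \sum_(k <- r | p k) (atG s (A k) : Op).
Proof.
apply: mx_ket_ext => -[x i]; rewrite mulmx_suml atG_ket.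
under [RHS]eq_bigr => k _ do rewrite atG_ket.
rewrite exchange_big; apply: eq_bigr => g _ /=.
by rewrite summxE scaler_suml.
Qed.

Lemma atG_mul (s : gsite rot) (A B : 'Op[R]_G) :
  (atG s A : Op) * atG s B = atG s (A *m B).
Proof.
apply: mx_ket_ext => -[x i]; rewrite mulr_ket !atG_ket mulmx_sumr.
under eq_bigr => g _ do rewrite -scalemxAr atG_ket scaler_sumr.
rewrite exchange_big; apply: eq_bigr => g _ /=.
under eq_bigr => h _ do rewrite upd_upd upd_eq scalerA.
rewrite -scaler_suml mxE (reindex (@enum_rank G)) /=; last first.
  by exists enum_val => h _; rewrite ?enum_rankK ?enum_valK.
by congr (_ *: _); apply: eq_bigr => h _; rewrite mulrC.
Qed.

Lemma atI_mul (s : isite rot) (A B : 'Op[R]_'I_6) :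
  (atI G s A : Op) * atI G s B = atI G s (A *m B).
Proof.
apply: mx_ket_ext => -[x i]; rewrite mulr_ket !atI_ket mulmx_sumr.
under eq_bigr => g _ do rewrite -scalemxAr atI_ket scaler_sumr.
rewrite exchange_big; apply: eq_bigr => g _ /=.
under eq_bigr => h _ do rewrite upd_upd upd_eq scalerA.
rewrite -scaler_suml mxE (reindex (@enum_rank 'I_6)) /=; last first.
  by exists enum_val => h _; rewrite ?enum_rankK ?enum_valK.
by congr (_ *: _); apply: eq_bigr => h _; rewrite mulrC.
Qed.

Lemma atG_comm (s t : gsite rot) (A B : 'Op[R]_G) : s != t ->
  (atG s A : Op) * atG t B = atG t B * atG s A.
Proof.
move=> st; apply: mx_ket_ext => -[x i]; rewrite !mulr_ket !atG_ket !mulmx_sumr.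
under eq_bigr => g _ do rewrite -scalemxAr atG_ket scaler_sumr.
under [RHS]eq_bigr => g _ do rewrite -scalemxAr atG_ket scaler_sumr.
rewrite exchange_big; apply: eq_bigr => g _; apply: eq_bigr => h _ /=.
have ts : t != s by rewrite eq_sym.
by rewrite !scalerA mulrC (updC _ _ _ st) !upd_neq.
Qed.

Lemma atI_comm (s t : isite rot) (A B : 'Op[R]_'I_6) : s != t ->
  (atI G s A : Op) * atI G t B = atI G t B * atI G s A.
Proof.
move=> st; apply: mx_ket_ext => -[x i]; rewrite !mulr_ket !atI_ket !mulmx_sumr.
under eq_bigr => g _ do rewrite -scalemxAr atI_ket scaler_sumr.
under [RHS]eq_bigr => g _ do rewrite -scalemxAr atI_ket scaler_sumr.
rewrite exchange_big; apply: eq_bigr => g _; apply: eq_bigr => h _ /=.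
have ts : t != s by rewrite eq_sym.
by rewrite !scalerA mulrC (updC _ _ _ st) !upd_neq.
Qed.

Lemma atG_atI_comm (s : gsite rot) (t : isite rot) (A : 'Op[R]_G) (B : 'Op[R]_'I_6) :
  (atG s A : Op) * atI G t B = atI G t B * atG s A.
Proof.
apply: mx_ket_ext => -[x i]; rewrite !mulr_ket !atG_ket !atI_ket !mulmx_sumr.
under eq_bigr => g _ do rewrite -scalemxAr atG_ket scaler_sumr.
under [RHS]eq_bigr => g _ do rewrite -scalemxAr atI_ket scaler_sumr.
rewrite exchange_big; apply: eq_bigr => g _; apply: eq_bigr => h _ /=.
by rewrite !scalerA mulrC.
Qed.

Definition pmx (w : {perm X}) : Op := mxket (fun c => ket (w c.1, c.2)).

Lemma pmx_ket w x i : pmx w *m ket (x, i) = ket (w x, i).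
Proof. by rewrite mxketE. Qed.

Lemma dagger_pmx w : dagger (pmx w) = pmx w^-1%g.
Proof.
apply/matrixP=> a b; rewrite daggerE -[a]enum_valK -[b]enum_valK !mxE !enum_rankK.
case: (enum_val a) (enum_val b) => [x i] [y j] /=.
rewrite !(inj_eq enum_rank_inj) !andbT rmorph_nat; congr (_%:R).
rewrite !xpair_eqE (eq_sym j); congr ((_ && _) : nat).
by rewrite -[RHS](inj_eq (@perm_inj _ w)) permKV eq_sym.
Qed.

Lemma pmx1 : pmx 1 = 1.
Proof. by apply: mx_ket_ext => -[x i]; rewrite pmx_ket perm1 mul1mx. Qed.

Definition idx0 : F := [ffun=> idx6 0].

(** This operator vanishes unless all clocks stand at 0. Every state that hops produce from the
    ground space has this form, so [V] is reduced to multiplying permutations and moving clock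
    readings. *)
Definition excite (u : {perm X}) (i : F) : Op :=
  mxket (fun c => if c.2 == idx0 then ket (u c.1, i) else 0).

Lemma excite_ket u i x j :
  excite u i *m ket (x, j) = if j == idx0 then ket (u x, i) else 0.
Proof. by rewrite mxketE. Qed.

Lemma pmx_excite w u i : pmx w * excite u i = excite (u * w)%g i.
Proof.
apply: mx_ket_ext => -[x j]; rewrite mulr_ket !excite_ket.
by case: ifP => _; rewrite ?mulmx0 // pmx_ket permM.
Qed.

Lemma atI_excite s a b u i :
  atI G s (ketbra R a b) * excite u i = if i s == b then excite u (upd i s a) else 0.
Proof.
apply: mx_ket_ext => -[x j]; rewrite mulr_ket !excite_ket.
case: ifP => [/eqP ->|j0]; first rewrite atI_ketbra_ket.
  by case: ifP => _; rewrite ?mul0mx // excite_ket eqxx.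
by case: ifP => _; rewrite ?mulmx0 ?mul0mx // excite_ket j0.
Qed.

Lemma zero6_excite s u i :
  atI G s (zero6 R) * excite u i = if i s == idx6 0 then excite u i else 0.
Proof. by rewrite atI_excite; case: eqP => // <-; rewrite upd_id. Qed.

(** The permutation neither reads nor changes the register at [s], hence commutes with every
    operator there. *)
Definition oblivious (u : {perm X}) (s : gsite rot) : Prop :=
  forall x g, u (upd x s g) = upd (u x) s g.

Lemma oblivious1 s : oblivious 1 s.
Proof. by move=> x g; rewrite !perm1. Qed.

Lemma obliviousM u w s : oblivious u s -> oblivious w s -> oblivious (u * w)%g s.
Proof. by move=> hu hw x g; rewrite !permM hu hw. Qed.

Lemma obliviousV u s : oblivious u s -> oblivious u^-1%g s.
Proof. by move=> hu x g; apply: (@perm_inj _ u); rewrite hu !permKV. Qed.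

Lemma oblivious_prod (I : Type) (r : seq I) (u : I -> {perm X}) s :
  (forall k, oblivious (u k) s) -> oblivious (\prod_(k <- r) u k)%g s.
Proof.
move=> hu; elim: r => [|k r IHr]; first by rewrite big_nil; exact: oblivious1.
by rewrite big_cons; apply: obliviousM.
Qed.

Lemma oblivious_val u s x : oblivious u s -> (u x) s = x s.
Proof. by move=> hu; rewrite -{1}(upd_id x s) hu upd_eq. Qed.

Lemma atG_excite s (A : 'Op[R]_G) u i : oblivious u s ->
  atG s A * excite u i = excite u i * atG s A.
Proof.
move=> hu; apply: mx_ket_ext => -[x j]; rewrite !mulr_ket excite_ket atG_ket.
rewrite mulmx_sumr; under [RHS]eq_bigr => g _ do rewrite -scalemxAr excite_ket.
case: ifP => _; last by rewrite mulmx0 big1 // => g _; rewrite scaler0.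
by rewrite atG_ket oblivious_val //; apply: eq_bigr => g _; rewrite hu.
Qed.

(** The product of all [zero6] projections fixes [A] and lets only kets with all clocks at 0
    through; on those the two operators agree. *)
Lemma pmx_idx0 u (A : Op) :
  (forall s, atI G s (zero6 R) * A = A) -> excite u idx0 * A = pmx u * A.
Proof.
move=> zA.
have prodE (r : seq (isite rot)) x i :
    (\prod_(s <- r) atI G s (zero6 R) : Op) *m ket (x, i) =
    if all (fun s => i s == idx6 0) r then ket (x, i) else 0.
  elim: r => [|s r IHr]; first by rewrite big_nil mul1mx.
  rewrite big_cons mulr_ket IHr /=; case: ifP => _; last by rewrite andbF mulmx0.
  by rewrite atI_ketbra_ket andbT; case: eqP => // <-; rewrite upd_id.
have prodA (r : seq (isite rot)) : (\prod_(s <- r) atI G s (zero6 R)) * A = A.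
  elim: r => [|s r IHr]; first by rewrite big_nil mul1r.
  by rewrite big_cons -mulrA IHr zA.
rewrite -{1 2}[A](prodA (enum (isite rot))) !mulrA; congr (_ * A).
apply: mx_ket_ext => -[x i]; rewrite !mulr_ket prodE; case: ifP => [/allP i0|_].
  rewrite excite_ket pmx_ket; have -> : i = idx0.
    by apply/ffunP=> s; rewrite ffunE; apply/eqP/i0; rewrite mem_enum.
  by rewrite eqxx.
by rewrite !mulmx0.
Qed.

End LocalOperators.

(** * Incidence of darts, vertices and plaquettes *)

Section Incidence.
Variables (E : finType) (rot : {perm dart E}).

Lemma mem_vertex (v : vertex rot) d : d \in val v -> source rot d = v.
Proof.
move=> dv; apply: val_inj => /=; have /imsetP[x _ vE] := valP v.
by rewrite -[RHS]/(val _) vE; apply/eqP; rewrite eq_porbit_mem -vE.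
Qed.

Lemma mem_plaquette (p : plaquette rot) d : d \in val p -> right_of rot d = p.
Proof.
move=> dv; apply: val_inj => /=; have /imsetP[x _ vE] := valP p.
by rewrite -[RHS]/(val _) vE; apply/eqP; rewrite eq_porbit_mem -vE.
Qed.

Lemma porbit_expg_mem (T : finType) (s : {perm T}) x y i :
  x \in porbit s y -> (s ^+ i)%g x \in porbit s y.
Proof. by rewrite -eq_porbit_mem => /eqP <-; exact: mem_porbit. Qed.

Lemma vertex_expg (v : vertex rot) d i : d \in val v -> (rot ^+ i)%g d \in val v.
Proof. by have /imsetP[x _ ->] := valP v; exact: porbit_expg_mem. Qed.

Lemma plaquette_expg (p : plaquette rot) d i :
  d \in val p -> (face rot ^+ i)%g d \in val p.
Proof. by have /imsetP[x _ ->] := valP p; exact: porbit_expg_mem. Qed.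

Lemma plaquette_expVg (p : plaquette rot) d i :
  d \in val p -> ((face rot)^-1 ^+ i)%g d \in val p.
Proof.
by have /imsetP[x _ ->] := valP p; rewrite -porbitV; exact: porbit_expg_mem.
Qed.

Lemma vertex_dart (v : vertex rot) d : d \in val v ->
  v = vminus rot d.1 \/ v = vplus rot d.1.
Proof. by move/mem_vertex <-; case: d => e [] /=; [left|right]. Qed.

Lemma plaquette_dart (p : plaquette rot) d : d \in val p ->
  p = pminus rot d.1 \/ p = pplus rot d.1.
Proof. by move/mem_plaquette <-; case: d => e [] /=; [right|left]. Qed.

Lemma clockwise_star_incident (v : vertex rot) e i : clockwise_star v e ->
  v = vminus rot (e i) \/ v = vplus rot (e i).
Proof. by move=> [d dv ->]; apply: vertex_dart; exact: vertex_expg. Qed.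

Lemma clockwise_boundary_incident (p : plaquette rot) e i : clockwise_boundary p e ->
  p = pminus rot (e i) \/ p = pplus rot (e i).
Proof. by move=> [d dv ->]; apply: plaquette_dart; exact: plaquette_expg. Qed.

Lemma counterclockwise_boundary_incident (p : plaquette rot) e i :
  counterclockwise_boundary p e ->
  p = pminus rot (e i) \/ p = pplus rot (e i).
Proof. by move=> [d dv ->]; apply: plaquette_dart; exact: plaquette_expVg. Qed.

End Incidence.

(** * Controlled permutations and ordered products of gates *)

Section ControlledPermutations.
Variables (S : finType) (G : finGroupType).
Local Notation X := {ffun S -> G}.

Lemma controlled_inj (a b : S) (f : G -> {perm G}) : a != b ->
  injective (fun x : X => upd x a (f (x b) (x a))).
Proof.
move=> ab x y /ffunP xy; apply/ffunP=> t.
have xyb : x b = y b by have := xy b; rewrite !upd_neq // eq_sym.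
have := xy t; rewrite !updE; case: eqP => // ->; rewrite xyb.
exact: perm_inj.
Qed.

(** [a] is the target and [b] the control. Vertex gates write on an edge under control of [R^v],
    plaquette gates write on [R^p] under control of an edge; only this opposition can make two gates
    fail to commute. *)
Definition cperm (a b : S) (ab : a != b) (f : G -> {perm G}) : {perm X} :=
  perm (@controlled_inj a b f ab).

Lemma cpermE a b (ab : a != b) f x : cperm ab f x = upd x a (f (x b) (x a)).
Proof. by rewrite permE. Qed.

Lemma cperm_comm (a b a' b' : S) (ab : a != b) (ab' : a' != b') (f f' : G -> {perm G}) :
  a != b' -> a' != b ->
  (a = a' -> forall g g' z, f' g' (f g z) = f g (f' g' z)) ->
  commute (cperm ab f) (cperm ab' f').
Proof.
move=> n1 n2 ff'; apply/permP=> x; rewrite !permM !cpermE.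
have [aa'|na] := eqVneq a a'.
  subst a'; rewrite !upd_upd !upd_eq !upd_neq 1?eq_sym //.
  by rewrite ff'.
rewrite !(upd_neq _ _ (_ : b' != a)) 1?eq_sym // !(upd_neq _ _ (_ : b != a')) 1?eq_sym //.
by rewrite !(upd_neq _ _ (_ : a' != a)) 1?eq_sym // !(upd_neq _ _ na) updC.
Qed.

Definition lmul (g : G) : {perm G} := perm (mulgI g).
Definition rmulV (g : G) : {perm G} := perm (mulIg g^-1%g).

Lemma lmulE g z : lmul g z = (g * z)%g.
Proof. by rewrite permE. Qed.

Lemma rmulVE g z : rmulV g z = (z * g^-1)%g.
Proof. by rewrite permE. Qed.

End ControlledPermutations.

(** The new factor [w] is pushed to the right end through the later factors. A hop of one clock
    thereby becomes right multiplication of the whole product of walks. *)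
Lemma prod_update (gT : finGroupType) (I : eqType) (r : seq I) (f f' : I -> gT) (s : I)
    (w : gT) :
  uniq r -> s \in r -> f' s = (f s * w)%g ->
  (forall t, t != s -> f' t = f t) -> (forall t, t != s -> commute w (f t)) ->
  (\prod_(t <- r) f' t = (\prod_(t <- r) f t) * w)%g.
Proof.
elim: r => // t r IHr /= /andP[tr ur]; rewrite inE !big_cons => /predU1P[st|sr] fs ft wf.
  rewrite -st fs -!mulgA; congr (_ * _)%g; subst t.
  rewrite (eq_big_seq f) => [|t tin]; last by apply: ft; apply: contraNneq tr => <-.
  have : forall t, t \in r -> t != s by move=> t tin; apply: contraNneq tr => <-.
  elim: (r) => [|t r' IH] rs; first by rewrite big_nil mulg1 mul1g.
  rewrite !big_cons mulgA wf; last by apply: rs; rewrite mem_head.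
  by rewrite -!mulgA IH // => t' t'r; apply: rs; rewrite inE t'r orbT.
rewrite (IHr ur sr fs ft wf) mulgA ft //.
by apply: contraNneq tr => ->.
Qed.

Section Residues.

Definition residue6 (n : int) : 'I_6 := idx6 `|(n %% 6)%Z|%N.

Lemma val_idx6 k : idx6 k = (k %% 6)%N :> nat.
Proof. by rewrite inordK // ltn_mod. Qed.

Lemma idx6_ord (i : 'I_6) : idx6 i = i.
Proof. by apply: val_inj; rewrite /= val_idx6 modn_small. Qed.

Lemma residue6_add1 n : residue6 (n + 1) = idx6 (residue6 n).+1.
Proof. by apply: val_inj => /=; rewrite /residue6 !val_idx6; lia. Qed.

Lemma residue6_sub1 n i : (i < 6)%N -> (residue6 n == idx6 i.+1) = (residue6 (n - 1) == i :> nat).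
Proof.
by move=> i6; rewrite -(inj_eq val_inj) /= /residue6 !val_idx6; lia.
Qed.

(** The range is the largest symmetric one: positions 6 and -6 have residue 0 too. *)
Lemma residue6_eq0 n : (`|n|%N <= 5)%N -> (residue6 n == idx6 0) = (n == 0).
Proof. by move=> n5; rewrite -(inj_eq val_inj) /= /residue6 !val_idx6; lia. Qed.

End Residues.

(** * Gates and hopping of the clocks *)

Section EdgePermutations.
Variables (R : realType) (G : finGroupType) (E : finType) (rot : {perm dart E}).
Local Notation X := {ffun gsite rot -> G}.
Local Notation Op := 'Op[R]_(config G rot).
Local Notation ket := (@ket R (config G rot)).

Definition vertex_act (v : vertex rot) (e : E) (g : G) : {perm G} :=
  if v == vplus rot e then lmul g else rmulV g.

Definition edge_val (p : plaquette rot) (e : E) (z : G) : G :=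
  if p == pplus rot e then z else z^-1%g.

Lemma edge_vertex_neq (e : E) (s : isite rot) : inl e != inr s :> gsite rot.
Proof. by []. Qed.

Lemma vertex_edge_neq (e : E) (s : isite rot) : inr s != inl e :> gsite rot.
Proof. by []. Qed.

Definition vert_perm (v : vertex rot) (e : E) : {perm X} :=
  cperm (edge_vertex_neq e (inl v)) (vertex_act v e).

Definition plaq_perm (p : plaquette rot) (e : E) : {perm X} :=
  cperm (vertex_edge_neq e (inr p)) (fun z => lmul (edge_val p e z)).

Lemma Lop_ket g e (v : vertex rot) x i :
  Lop R g e v *m ket (x, i) =
  ket (upd x (inl e) (vertex_act v e g (x (inl e))), i).
Proof.
rewrite /Lop /vertex_act; case: ifP => _.
  rewrite /Lplus atG_sum mulmx_suml (bigD1 (x (inl e))) //= atG_ketbra_ket eqxx lmulE.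
  rewrite big1 ?addr0 // => z ze.
  by rewrite atG_ketbra_ket eq_sym (negbTE ze).
rewrite /Lminus atG_sum mulmx_suml (bigD1 (x (inl e))) //= atG_ketbra_ket eqxx rmulVE.
rewrite big1 ?addr0 // => z ze.
by rewrite atG_ketbra_ket eq_sym (negbTE ze).
Qed.

Lemma Top_ket h e (p : plaquette rot) x i :
  Top R h e p *m ket (x, i) =
  if edge_val p e (x (inl e)) == h then ket (x, i) else 0.
Proof.
rewrite /Top /edge_val /Tplus /Tminus; case: ifP => _; rewrite atG_ketbra_ket.
  by case: eqP => // <-; rewrite upd_id.
rewrite (can2_eq invgK invgK); case: eqP => // <-; first by rewrite upd_id.
Qed.

Lemma MV_pmx (v : vertex rot) e : MV R G v e = pmx R (vert_perm v e).
Proof.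
apply: mx_ket_ext => -[x i]; rewrite pmx_ket cpermE mulmx_suml.
rewrite (bigD1 (x (inr (inl v)))) //= mulr_ket atG_ketbra_ket eqxx upd_id Lop_ket.
rewrite big1 ?addr0 // => g gx.
by rewrite mulr_ket atG_ketbra_ket eq_sym (negbTE gx) mulmx0.
Qed.

Lemma MP_pmx (p : plaquette rot) e : MP R G p e = pmx R (plaq_perm p e).
Proof.
apply: mx_ket_ext => -[x i]; rewrite pmx_ket cpermE mulmx_suml lmulE.
have shift g : atG (inr (inr p)) (\sum_(z : G) ketbra R (g * z)%g z) *m ket (x, i) =
    ket (upd x (inr (inr p)) (g * x (inr (inr p)))%g, i).
  rewrite atG_sum mulmx_suml (bigD1 (x (inr (inr p)))) //= atG_ketbra_ket eqxx.
  rewrite big1 ?addr0 // => z zx.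
  by rewrite atG_ketbra_ket eq_sym (negbTE zx).
rewrite (bigD1 (edge_val p e (x (inl e)))) //= mulr_ket shift Top_ket upd_neq // eqxx.
rewrite big1 ?addr0 // => g gx.
by rewrite mulr_ket shift Top_ket upd_neq // eq_sym (negbTE gx).
Qed.

Lemma vert_perm_oblivious (v : vertex rot) e t : t != inl v -> oblivious (vert_perm v e) (inr t).
Proof.
move=> tv x g; have n1 := edge_vertex_neq e t.
have n2 : inr (inl v) != inr t :> gsite rot by apply: contraNneq tv => -[->].
have n3 := vertex_edge_neq e t.
by rewrite !cpermE (upd_neq _ _ n1) (upd_neq _ _ n2) (updC _ _ _ n3).
Qed.

Lemma plaq_perm_oblivious (p : plaquette rot) e t : t != inr p -> oblivious (plaq_perm p e) (inr t).
Proof.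
move=> tp x g; have n1 := edge_vertex_neq e t.
have n2 : inr (inr p) != inr t :> gsite rot by apply: contraNneq tp => -[->].
have n3 : inr t != inr (inr p) :> gsite rot by rewrite eq_sym.
by rewrite !cpermE (upd_neq _ _ n1) (upd_neq _ _ n2) (updC _ _ _ n3).
Qed.

End EdgePermutations.

Lemma big_ord6_split (M : nmodType) (f : nat -> M) :
  \sum_(i < 6) f i = \sum_(i < 3) f i + \sum_(3 <= i < 6) f i.
Proof. by rewrite -(big_mkord xpredT f) (big_cat_nat _ (n := 3)) //= big_mkord. Qed.

Section Excitations.
Variables (R : realType) (G : finGroupType) (E : finType) (rot : {perm dart E}).
Variables (ev : vertex rot -> 'I_3 -> E) (ep : plaquette rot -> 'I_6 -> E).
Hypothesis incV : forall v i, v = vminus rot (ev v i) \/ v = vplus rot (ev v i).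
Hypothesis incP : forall p i, p = pminus rot (ep p i) \/ p = pplus rot (ep p i).
Local Notation X := {ffun gsite rot -> G}.
Local Notation F := {ffun isite rot -> 'I_6}.
Local Notation Op := 'Op[R]_(config G rot).
Local Notation ket := (@ket R (config G rot)).
Implicit Types (s t : isite rot) (i : nat) (z : F) (u w : {perm X}).

(** The gate of the step from [i] to [i+1]. A vertex has only three gates; its other three steps are
    trivial and pad its cycle to length 6, so that vertices and plaquettes contribute at the same
    order. *)
Definition hop s i : {perm X} :=
  match s with
  | inl v => if (i < 3)%N then vert_perm G v (ev v (inord i)) else 1%g
  | inr p => plaq_perm G p (ep p (inord i))
  end.

Definition blockers s i : seq (isite rot) :=
  match s with
  | inl v => if (i < 3)%N then
      [:: inr (pminus rot (ev v (inord i))); inr (pplus rot (ev v (inord i)))] else [::]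
  | inr p =>
      [:: inl (vminus rot (ep p (inord i))); inl (vplus rot (ep p (inord i)))]
  end.

Lemma self_blockers s i : s \notin blockers s i.
Proof. by case: s => [v|p] /=; rewrite ?inE //; case: ifP; rewrite ?inE. Qed.

(** Two vertex gates can share an edge only from its two ends, where they act by left and right
    multiplication. Two plaquette gates only read edges and write on different registers. A vertex
    gate and a plaquette gate interfere only on a common edge, and then [t] is a blocker of [s]. *)
Lemma hop_comm s t i j : t != s -> t \notin blockers s i -> commute (hop s i) (hop t j).
Proof.
case: s t => [v|p] [v'|p'] ts /=.
- move=> _; case: ifP => _; last by move=> *; exact/commute_sym/commute1.
  case: ifP => _; last exact: commute1.
  apply: cperm_comm => //; case=> ee g g' z.
  have vv' : v' != v by apply: contraNneq ts => ->.
  rewrite /vertex_act -ee; have := incV v (inord i); have := incV v' (inord j).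
  rewrite -ee; set e := ev v _ => iv' iv.
  have [ve|nv] := eqVneq v (vplus rot e); have [ve'|nv'] := eqVneq v' (vplus rot e).
  + by rewrite ve ve' eqxx in vv'.
  + by rewrite !lmulE !rmulVE mulgA.
  + by rewrite !lmulE !rmulVE mulgA.
  + case: iv => e1; last by rewrite -e1 eqxx in nv.
    case: iv' => e2; last by rewrite -e2 eqxx in nv'.
    by rewrite e2 -e1 eqxx in vv'.
- case: ifP => _; last by move=> *; exact/commute_sym/commute1.
  rewrite !inE negb_or => /andP[n1 n2].
  apply: cperm_comm => //; apply/eqP => -[ee].
  by case: (incP p' (inord j)) => pe; rewrite pe -ee eqxx // in n1 n2.
- rewrite !inE negb_or => /andP[n1 n2].
  case: ifP => _; last exact: commute1.
  apply: cperm_comm => //; apply/eqP => -[ee].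
  by case: (incV v' (inord j)) => pe; rewrite pe ee eqxx // in n1 n2.
- move=> _; apply: cperm_comm => //; case=> pp.
  by rewrite pp eqxx in ts.
Qed.

Lemma hop_oblivious s t i : t != s -> oblivious (hop s i) (inr t).
Proof.
case: s => [v|p] ts /=; last exact: plaq_perm_oblivious.
by case: ifP => _; [exact: vert_perm_oblivious | exact: oblivious1].
Qed.

Definition blockade s i : Op := \prod_(t <- blockers s i) atI G t (zero6 R).

Definition hopping s i : Op :=
  dagger (pmx R (hop s i)) * atI G s (step6 R i) * blockade s i.

Lemma Vperturbation_hopping :
  Vperturbation R G ev ep = \sum_s \sum_(i < 6) plus_hc (hopping s i).
Proof.
rewrite big_sumType; congr (_ + _); last first.
  apply: eq_bigr => p _; apply: eq_bigr => i _; congr plus_hc.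
  rewrite /hopping /blockade /hop /blockers inord_val MP_pmx.
  by rewrite !big_cons big_nil mulr1 !mulrA.
apply: eq_bigr => v _.
rewrite (big_ord6_split (fun i => plus_hc (hopping (inl v) i))).
congr (_ + _).
  apply: eq_bigr => i _; congr plus_hc.
  rewrite /hopping /blockade /hop /blockers ltn_ord inord_val MV_pmx.
  by rewrite !big_cons big_nil mulr1 !mulrA.
apply: eq_big_nat => i /andP[i3 i6]; congr plus_hc.
rewrite /hopping /blockade /hop /blockers ltnNge i3 /= big_nil mulr1 pmx1.
by rewrite (_ : dagger (1 : Op) = 1) ?mul1r // /dagger; exact: dagger1.
Qed.

Lemma blockade_excite s i u z :
  blockade s i * excite R u z =
  if all (fun t => z t == idx6 0) (blockers s i) then excite R u z else 0.
Proof.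
rewrite /blockade; elim: (blockers s i) => [|t r IHr]; first by rewrite big_nil mul1r.
rewrite big_cons -mulrA IHr /=; case: (all _ r); last by rewrite mulr0 andbF.
by rewrite zero6_excite andbT.
Qed.

Lemma dagger_blockade_excite s i u z :
  dagger (blockade s i) * excite R u z =
  if all (fun t => z t == idx6 0) (blockers s i) then excite R u z else 0.
Proof.
rewrite /blockade; elim: (blockers s i) => [|t r IHr].
  by rewrite big_nil (_ : dagger (1 : Op) = 1) ?mul1r // /dagger; exact: dagger1.
rewrite big_cons [dagger _]daggerM dagger_atI dagger_ketbra mulmxE -mulrA zero6_excite /=.
by case: ifP => _ //; rewrite mulr0.
Qed.

Lemma hopping_excite s i u z : (i < 6)%N ->
  hopping s i * excite R u z =
  if (z s == i :> nat) && all (fun t => z t == idx6 0) (blockers s i)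
  then excite R (u * (hop s i)^-1)%g (upd z s (idx6 i.+1)) else 0.
Proof.
move=> i6; rewrite /hopping -mulrA blockade_excite andbC.
case: ifP => _; last by rewrite mulr0.
rewrite -mulrA /step6 atI_excite -(inj_eq val_inj) /= val_idx6 modn_small //.
by case: ifP => _; rewrite ?mulr0 // dagger_pmx pmx_excite.
Qed.

Lemma dagger_hopping_excite s i u z : (i < 6)%N ->
  dagger (hopping s i) * excite R u z =
  if (z s == idx6 i.+1) && all (fun t => z t == idx6 0) (blockers s i)
  then excite R (u * hop s i)%g (upd z s (idx6 i)) else 0.
Proof.
move=> i6; rewrite /hopping [dagger (_ * _)]daggerM [dagger (_ * _)]daggerM daggerK.
rewrite dagger_atI dagger_ketbra !mulmxE -!mulrA pmx_excite atI_excite.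
case: ifP => _; last by rewrite mulr0.
rewrite dagger_blockade_excite; congr (if _ then _ else _).
(* The blockade is tested after clock [s] has been moved, but [s] is not among its own blockers. *)
apply: eq_in_all => t tb; rewrite upd_neq //.
by apply: contraTneq tb => ->; exact: self_blockers.
Qed.

Lemma Vperturbation_excite u z :
  Vperturbation R G ev ep * excite R u z =
  \sum_s \sum_(i < 6)
   ((if (z s == i :> nat) && all (fun t => z t == idx6 0) (blockers s i)
     then excite R (u * (hop s i)^-1)%g (upd z s (idx6 i.+1)) else 0) +
    (if (z s == idx6 i.+1) && all (fun t => z t == idx6 0) (blockers s i)
     then excite R (u * hop s i)%g (upd z s (idx6 i)) else 0)).
Proof.
rewrite Vperturbation_hopping mulr_suml; apply: eq_bigr => s _.
rewrite mulr_suml; apply: eq_bigr => i _.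
by rewrite /plus_hc mulrDl hopping_excite // dagger_hopping_excite.
Qed.

End Excitations.

(** * The unperturbed Hamiltonian *)

Section LocalProjections.
Variables (R : realType) (G : finGroupType) (E : finType) (rot : {perm dart E}).
Local Notation Op := 'Op[R]_(config G rot).
Implicit Types s t : isite rot.

Definition psi_proj s : 'Op[R]_G :=
  match s with inl _ => projPsiV R G | inr _ => projPsiP R G end.

Definition site_proj s : Op := atG (inr s) (psi_proj s) * atI G s (zero6 R).

Lemma projPsiVE : projPsiV R G = const_mx (#|G|%:R)^-1.
Proof.
have psiE i : PsiV R G i 0 = (sqrtC #|G|%:R)^-1.
  rewrite !mxE summxE (bigD1 (enum_val i)) // enum_valK !mxE !eqxx /=.
  rewrite big1 ?addr0 ?mulr1 // => g gi.
  rewrite mxE; case: eqP => [e|//]; by rewrite e enum_rankK eqxx in gi.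
apply/matrixP=> i j; rewrite mxE big_ord1 daggerE !psiE mxE conj_Creal; last first.
  by rewrite realV sqrtC_real // ler0n.
by rewrite -invfM -expr2 sqrtCK.
Qed.

Lemma psi_proj_idem s : psi_proj s *m psi_proj s = psi_proj s.
Proof.
case: s => [v|p] /=; last by rewrite /projPsiP /ketbra mul_delta_mx.
have G0 : #|G|%:R != 0 :> R[i] by rewrite pnatr_eq0 -lt0n; apply/card_gt0P; exists 1%g.
rewrite projPsiVE; apply/matrixP=> i j; rewrite !mxE.
under eq_bigr => k _ do rewrite !mxE.
by rewrite sumr_const card_ord -[LHS]mulr_natl mulrA divff // mul1r.
Qed.

Lemma dagger_psi_proj s : dagger (psi_proj s) = psi_proj s.
Proof.
case: s => [v|p] /=; last exact: dagger_ketbra.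
by rewrite /projPsiV daggerM daggerK.
Qed.

Lemma zero6_idem : zero6 R *m zero6 R = zero6 R.
Proof. by rewrite /zero6 /ketbra mul_delta_mx. Qed.

Lemma atI_zero6_site_proj s : atI G s (zero6 R) * site_proj s = site_proj s.
Proof. by rewrite /site_proj atG_atI_comm mulrA atI_mul zero6_idem. Qed.

Lemma atG_psi_site_proj s : atG (inr s) (psi_proj s) * site_proj s = site_proj s.
Proof. by rewrite /site_proj mulrA atG_mul psi_proj_idem. Qed.

Lemma site_proj_idem s : site_proj s * site_proj s = site_proj s.
Proof. by rewrite {1}/site_proj -mulrA atI_zero6_site_proj atG_psi_site_proj. Qed.

Lemma dagger_site_proj s : dagger (site_proj s) = site_proj s.
Proof.
rewrite [LHS]daggerM dagger_atG dagger_atI dagger_psi_proj dagger_ketbra mulmxE.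
by rewrite -atG_atI_comm.
Qed.

Lemma site_proj_comm s t : site_proj s * site_proj t = site_proj t * site_proj s.
Proof.
have [->//|st] := eqVneq s t; rewrite /site_proj.
have st' : inr s != inr t :> gsite rot by apply: contraNneq st => -[->].
rewrite mulrA -(mulrA _ _ (atG _ _)) -atG_atI_comm mulrA (atG_comm _ _ st') -!mulrA.
congr (_ * _); rewrite (atI_comm G _ _ st) !mulrA; congr (_ * _).
by rewrite atG_atI_comm.
Qed.

Lemma prod_site_proj_idem (r : seq (isite rot)) s : s \in r ->
  site_proj s * \prod_(t <- r) site_proj t = \prod_(t <- r) site_proj t.
Proof.
elim: r => // t r IHr; rewrite inE big_cons => /predU1P[->|/IHr sr].
  by rewrite mulrA site_proj_idem.
by rewrite mulrA site_proj_comm -mulrA sr.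
Qed.

Lemma prod_site_proj_comm (r : seq (isite rot)) (A : Op) :
  (forall s, A * site_proj s = site_proj s * A) ->
  A * \prod_(t <- r) site_proj t = (\prod_(t <- r) site_proj t) * A.
Proof.
move=> hA; elim: r => [|t r IHr]; first by rewrite big_nil mulr1 mul1r.
by rewrite big_cons mulrA hA -mulrA IHr mulrA.
Qed.

Lemma dagger_prod_site_proj (r : seq (isite rot)) :
  dagger (\prod_(t <- r) site_proj t) = \prod_(t <- r) site_proj t.
Proof.
elim: r => [|t r IHr]; first by rewrite big_nil; exact: dagger1.
rewrite big_cons [LHS]daggerM IHr dagger_site_proj mulmxE.
by rewrite -prod_site_proj_comm // => s; exact: site_proj_comm.
Qed.

Lemma projAux_prod : projAux R G rot = \prod_s site_proj s.
Proof. by rewrite big_sumType. Qed.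

Lemma site_proj_projAux s : site_proj s * projAux R G rot = projAux R G rot.
Proof. by rewrite projAux_prod prod_site_proj_idem ?mem_index_enum. Qed.

Lemma dagger_projAux : dagger (projAux R G rot) = projAux R G rot.
Proof. by rewrite projAux_prod dagger_prod_site_proj. Qed.

Lemma projAux_fix (A : Op) :
  (forall s, site_proj s * A = A) -> projAux R G rot * A = A.
Proof.
move=> hA; rewrite projAux_prod; elim: (index_enum _) => [|t r IHr].
  by rewrite big_nil mul1r.
by rewrite big_cons -mulrA IHr hA.
Qed.

Lemma projAux_idem : projAux R G rot * projAux R G rot = projAux R G rot.
Proof. by apply: projAux_fix; exact: site_proj_projAux. Qed.

Lemma atI_zero6_projAux s : atI G s (zero6 R) * projAux R G rot = projAux R G rot.
Proof. by rewrite -{1}(site_proj_projAux s) mulrA atI_zero6_site_proj site_proj_projAux. Qed.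

Lemma atG_psi_projAux s : atG (inr s) (psi_proj s) * projAux R G rot = projAux R G rot.
Proof. by rewrite -{1}(site_proj_projAux s) mulrA atG_psi_site_proj site_proj_projAux. Qed.

Definition defects : Op := \sum_s (1 - site_proj s).

Lemma Hunperturbed_defects :
  Hunperturbed R G rot = defects + (- #|{: isite rot}|%:R)%:C%:M.
Proof.
rewrite /defects sumrB sumr_const rmorphN rmorph_nat raddfN /=.
rewrite (_ : 1 *+ _ = #|{: isite rot}|%:R%:M :> Op); last by rewrite -[1]/(1%:M) -raddfMn.
rewrite addrAC subrr add0r big_sumType opprD addrC /Hunperturbed !sumrN.
by [].
Qed.

Lemma dagger_defects : dagger defects = defects.
Proof.
rewrite dagger_sum; apply: eq_bigr => s _.
by rewrite daggerD daggerN dagger_site_proj (dagger1 _ _).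
Qed.

Lemma defects_projAux : defects * projAux R G rot = 0.
Proof.
by rewrite mulr_suml big1 // => s _; rewrite mulrBl mul1r site_proj_projAux subrr.
Qed.

End LocalProjections.

Lemma quadform_proj_ge0 (R : realType) n (A : 'M[R[i]]_n) psi :
  dagger A = A -> A *m A = A -> 0 <= quadform A psi.
Proof.
move=> dA iA; suff -> : quadform A psi = quadform 1%:M (A *m psi).
  by rewrite quadform1 lecR; apply: sumr_ge0 => k _; rewrite exprn_ge0 ?normc_ge0.
by rewrite /quadform mulmx1 daggerM dA mulmxA -(mulmxA _ A A) iA.
Qed.

Section GroundProjection.
Variables (R : realType) (G : finGroupType) (E : finType) (rot : {perm dart E}).
Local Notation Op := 'Op[R]_(config G rot).
Local Notation ket := (@ket R (config G rot)).
Implicit Types s t : isite rot.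

Lemma prod_site_proj_idem2 (r : seq (isite rot)) :
  (\prod_(s <- r) site_proj R G s) * (\prod_(s <- r) site_proj R G s) =
  \prod_(s <- r) site_proj R G s.
Proof.
elim: r => [|s r IHr]; first by rewrite big_nil mulr1.
rewrite big_cons; set Q := \prod_(_ <- _) _ in IHr *; set P := site_proj R G s.
have PQ : P * Q = Q * P by apply: prod_site_proj_comm => t; exact: site_proj_comm.
by rewrite -mulrA (mulrA Q) -PQ -mulrA IHr mulrA site_proj_idem.
Qed.

(** A union bound for commuting projections: [1 - P * Q] is [(1 - P) + (1 - Q)] minus the projection
    [(1 - P) * (1 - Q)]. It makes the gap of [D] equal to 1, independently of the size of the
    lattice. *)
Lemma quadform_complement_le (r : seq (isite rot)) (psi : 'cV[R[i]]_#|config G rot|) :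
  quadform (1 - \prod_(s <- r) site_proj R G s) psi <=
  quadform (\sum_(s <- r) (1 - site_proj R G s)) psi.
Proof.
elim: r => [|s r IHr]; first by rewrite !big_nil subrr.
have Q2 := prod_site_proj_idem2 r; have dQ := dagger_prod_site_proj R G r.
rewrite !big_cons; set Q := \prod_(_ <- _) _ in IHr Q2 dQ *; set P := site_proj R G s.
have PQ : P * Q = Q * P by apply: prod_site_proj_comm => t; exact: site_proj_comm.
have P2 : P * P = P by exact: site_proj_idem.
have dP : dagger P = P by exact: dagger_site_proj.
clearbody Q P.
have -> : 1 - P * Q = (1 - P) + ((1 - Q) - (1 - P) * (1 - Q)).
  by rewrite [(1 - P) * _]mulrBl mul1r subKr mulrBr mulr1 addrA subrK.
rewrite quadformD [leRHS]quadformD lerD2l.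
apply: le_trans IHr; rewrite quadformD -[leRHS]addr0 lerD2l.
rewrite -scaleN1r quadformZ mulN1r oppr_le0.
have idC (A : Op) : A * A = A -> (1 - A) * (1 - A) = 1 - A.
  by move=> AA; rewrite mulrBr mulr1 mulrBl mul1r AA subrr subr0.
have dC (A : Op) : dagger A = A -> dagger (1 - A) = 1 - A.
  by move=> dA; rewrite daggerD daggerN dA (dagger1 _ _).
have comC : (1 - Q) * (1 - P) = (1 - P) * (1 - Q).
  rewrite !mulrBl !mul1r !mulrBr !mulr1 PQ !opprB addrACA [RHS]addrACA.
  by rewrite [- P - Q]addrC.
apply: quadform_proj_ge0; first by rewrite [LHS]daggerM !dC.
rewrite mulmxE -mulrA (mulrA (1 - Q)) comC -mulrA (idC Q Q2).
by rewrite (mulrA (1 - P) (1 - P)) (idC P P2).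
Qed.

Lemma defects_gap (psi : 'cV[R[i]]_#|config G rot|) : projAux R G rot *m psi = 0 ->
  quadform 1%:M psi <= quadform (defects R G rot) psi.
Proof.
move=> Ppsi; apply: le_trans (quadform_complement_le _ psi).
rewrite -projAux_prod quadformD -[leLHS]addr0 lerD2l.
by rewrite -scaleN1r quadformZ /quadform -mulmxA Ppsi mulmx0 mxE mulr0.
Qed.

Lemma projAux_neq0 : projAux R G rot != 0.
Proof.
(* The witness is a row vector constant in the edges and vertex registers, supported where all [R^p]
   are 1 and all clocks are 0; every site projection fixes it. *)
pose S (x : {ffun gsite rot -> G}) := [forall p : plaquette rot, x (inr (inr p)) == 1%g].
pose f : 'rV[R[i]]_#|config G rot| :=
  \row_k (S (enum_val k).1 && ((enum_val k).2 == idx0 rot))%:R.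
have f_ket x j : f *m ket (x, j) = (S x && (j == idx0 rot))%:R%:M.
  apply/matrixP=> a b; rewrite !ord1 -colE !mxE enum_rankK eqxx mulr1n.
  by [].
have G0 : #|G|%:R != 0 :> R[i] by rewrite pnatr_eq0 -lt0n; apply/card_gt0P; exists 1%g.
have f_site s : f *m site_proj R G s = f.
  apply/rowP=> k; rewrite -[k]enum_valK.
  suff : f *m site_proj R G s *m ket (enum_val k) = f *m ket (enum_val k).
    by move/matrixP/(_ 0 0); rewrite -!colE !mxE.
  case: (enum_val k) => x j {k}; rewrite -mulmxA mulr_ket atI_ketbra_ket.
  case: eqP => [j0|/eqP j0]; last first.
    rewrite !mulmx0 f_ket; case: eqP => [jE|_]; last by rewrite andbF raddf0.
    by rewrite jE ffunE eqxx in j0.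
  rewrite -j0 upd_id atG_ket mulmx_sumr.
  case: s j0 => [v|p] _ /=.
    under eq_bigr => g _ do rewrite -scalemxAr f_ket.
    rewrite projPsiVE (eq_bigr (fun _ => (#|G|%:R)^-1 *: (f *m ket (x, j)))).
      by rewrite sumr_const -scaler_nat scalerA divff // scale1r.
    move=> g _; rewrite mxE f_ket; congr (_ *: (nat_of_bool (_ && _))%:R%:M).
    by apply: eq_forallb => p; rewrite upd_neq.
  rewrite /projPsiP (bigD1 1%g) //= ketbraE eqxx /= big1 ?addr0 => [|g g1]; last first.
    by rewrite ketbraE (negbTE g1) scale0r mulmx0.
  rewrite -scalemxAr; case: eqP => [xp|/eqP xp].
    by rewrite scale1r -xp upd_id.
  rewrite scale0r f_ket (_ : S x = false) ?raddf0 //.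
  by apply/negbTE/forallPn; exists p.
have fP : f *m projAux R G rot = f.
  rewrite projAux_prod; elim: (index_enum _) => [|t r IHr].
    by rewrite big_nil mulmx1.
  by rewrite big_cons -mulmxE mulmxA f_site IHr.
apply/negP=> /eqP P0; rewrite P0 mulmx0 in fP.
have := f_ket [ffun=> 1%g] (idx0 rot); rewrite -fP mul0mx eqxx andbT.
have -> : S [ffun=> 1%g] by apply/forallP=> p; rewrite ffunE.
by move/matrixP/(_ 0 0)/eqP; rewrite !mxE eqxx eq_sym oner_eq0.
Qed.
End GroundProjection.

(** * Lifted clock positions *)

Section LiftedStates.
Variables (R : realType) (G : finGroupType) (E : finType) (rot : {perm dart E}).
Variables (ev : vertex rot -> 'I_3 -> E) (ep : plaquette rot -> 'I_6 -> E).
Hypothesis incV : forall v i, v = vminus rot (ev v i) \/ v = vplus rot (ev v i).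
Hypothesis incP : forall p i, p = pminus rot (ep p i) \/ p = pplus rot (ep p i).
Local Notation X := {ffun gsite rot -> G}.
Local Notation F := {ffun isite rot -> 'I_6}.
Local Notation Op := 'Op[R]_(config G rot).
Local Notation hop := (@hop G E rot ev ep).
Local Notation blockers := (@blockers E rot ev ep).
Local Notation V := (Vperturbation R G ev ep).
Local Notation P := (projAux R G rot).
Local Notation D := (defects R G rot).
Local Notation L := {ffun isite rot -> int}.
Implicit Types (s t : isite rot) (n : L) (k : int).

Definition at_site s k : L := [ffun t => if t == s then k else 0].

(* The left factor of a product of permutations acts first, so the first gate
   met is the leftmost; forward hops carry the inverse gate because [V] contains
   the adjoints of the [M_i]. *)
Definition walk s k : {perm X} :=
  match k with
  | Posz m => (\prod_(i < m) (hop s (residue6 (Posz i)))^-1)%g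
  | Negz m => (\prod_(i < m.+1) hop s (residue6 (Negz i)))%g
  end.

Lemma walk0 s : walk s 0 = 1%g.
Proof. by rewrite -[0]/(Posz 0) /walk big_ord0. Qed.

Lemma walk_up s k : walk s (k + 1) = (walk s k * (hop s (residue6 k))^-1)%g.
Proof.
case: k => [m|[|m]].
- by rewrite (_ : Posz m + 1 = Posz m.+1) ?[in LHS]/walk ?big_ord_recr //; lia.
- by rewrite (_ : Negz 0 + 1 = 0) // walk0 /walk big_ord1 mulgV.
- rewrite (_ : Negz m.+1 + 1 = Negz m); last by lia.
  by rewrite {2}/walk big_ord_recr /= mulgK.
Qed.

Lemma walk_down s k : walk s (k - 1) = (walk s k * hop s (residue6 (k - 1)))%g.
Proof. by rewrite -{2}[k](subrK 1) walk_up mulgKV. Qed.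

Lemma walk_comm s k w : (forall j, commute w (hop s j)) -> commute w (walk s k).
Proof.
move=> wh; case: k => m; apply: commute_prod => i _ //.
by apply: commuteV.
Qed.

Lemma walk_oblivious s t k : t != s -> oblivious (walk s k) (inr t).
Proof.
move=> ts; case: k => m; apply: oblivious_prod => i.
  by apply: obliviousV; exact: hop_oblivious.
exact: hop_oblivious.
Qed.

Definition walks n : {perm X} := (\prod_(t : isite rot) walk t (n t))%g.
Definition residues n : F := [ffun t => residue6 (n t)].

(* [n t] is the position of the clock [I^t] on the universal cover of the
   cycle [Z/6]: this is what makes paths that turn back undo themselves. *)
Definition lifted n : Op := excite R (walks n) (residues n) * P.

(** A blocker at position 0 has a trivial walk, and the walk of any other site commutes with the
    gate by [hop_comm]. This is the purpose of the [|0>] projections in [V]. *)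
Lemma walks_up n s : (forall t, t \in blockers s (residue6 (n s)) -> n t = 0) ->
  walks (n + at_site s 1) = (walks n * (hop s (residue6 (n s)))^-1)%g.
Proof.
move=> blk; apply: (@prod_update _ _ _ _ _ s).
- exact: index_enum_uniq.
- exact: mem_index_enum.
- by rewrite !ffunE eqxx walk_up.
- by move=> t ts; rewrite !ffunE (negbTE ts) addr0.
move=> t ts; have [/blk ->|tb] := boolP (t \in blockers s (residue6 (n s))).
  by rewrite walk0; exact: commute1.
apply: walk_comm => j; apply/commute_sym/commuteV/commute_sym.
exact: hop_comm.
Qed.

Lemma walks_down n s :
  (forall t, t \in blockers s (residue6 (n s - 1)) -> n t = 0) ->
  walks (n - at_site s 1) = (walks n * hop s (residue6 (n s - 1)))%g.
Proof.
move=> blk; apply: (@prod_update _ _ _ _ _ s).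
- exact: index_enum_uniq.
- exact: mem_index_enum.
- by rewrite !ffunE eqxx walk_down.
- by move=> t ts; rewrite !ffunE (negbTE ts) subr0.
move=> t ts; have [/blk ->|tb] := boolP (t \in blockers s (residue6 (n s - 1))).
  by rewrite walk0; exact: commute1.
by apply: walk_comm => j; exact: hop_comm.
Qed.

Definition unblocked n s i := all (fun t => n t == 0) (blockers s i).

Definition within (b : nat) n := forall t, (`|n t| <= b)%N.

Lemma residues_blockers n s i : within 5 n ->
  all (fun t => residues n t == idx6 0) (blockers s i) = unblocked n s i.
Proof. by move=> n5; apply: eq_all => t; rewrite ffunE residue6_eq0. Qed.

Lemma residues_up n s :
  upd (residues n) s (idx6 (residue6 (n s)).+1) = residues (n + at_site s 1).
Proof.
apply/ffunP=> t; rewrite updE !ffunE; case: eqVneq => [->|_]; last by rewrite addr0.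
by rewrite residue6_add1.
Qed.

Lemma residues_down n s :
  upd (residues n) s (idx6 (residue6 (n s - 1))) = residues (n - at_site s 1).
Proof.
apply/ffunP=> t; rewrite updE !ffunE; case: eqVneq => [->|_]; last by rewrite subr0.
by rewrite idx6_ord.
Qed.

Lemma Vperturbation_lifted n : within 5 n ->
  V * lifted n = \sum_s
    ((if unblocked n s (residue6 (n s)) then lifted (n + at_site s 1) else 0) +
     (if unblocked n s (residue6 (n s - 1)) then lifted (n - at_site s 1) else 0)).
Proof.
move=> n5; rewrite /lifted mulrA Vperturbation_excite // mulr_suml.
apply: eq_bigr => s _; rewrite big_split mulrDl; congr (_ + _).
  (* Of the six forward hops of clock [s], only the one starting at its present residue acts. *)
  rewrite (bigD1 (residue6 (n s))) //= big1 => [|i ine].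
    rewrite ffunE eqxx addr0 residues_blockers //= residues_up.
    case: ifP => [/allP ok|_]; last by rewrite mul0r.
    by rewrite walks_up // => t /ok/eqP.
  by rewrite ffunE eq_sym (inj_eq val_inj) (negbTE ine).
rewrite (bigD1 (residue6 (n s - 1))) //= big1 => [|i ine].
  rewrite ffunE residue6_sub1 // eqxx addr0 residues_blockers //= residues_down.
  case: ifP => [/allP ok|_]; last by rewrite mul0r.
  by rewrite walks_down // => t /ok/eqP.
by rewrite ffunE residue6_sub1 // eq_sym (inj_eq val_inj) (negbTE ine).
Qed.

Lemma walks_oblivious n s : n s = 0 -> oblivious (walks n) (inr s).
Proof.
move=> ns; apply: oblivious_prod => t; have [->|ts] := eqVneq t s.
  by rewrite ns walk0; exact: oblivious1.
by apply: walk_oblivious; rewrite eq_sym.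
Qed.

(** A clock away from 0 is killed by [zero6]; at position 0 the other walks do not touch [R^s], so
    the projection reaches [P]. Only the position at [s] is bounded, which lets the lemma apply to
    the other sites of a full turn. *)
Lemma site_proj_lifted n s : (`|n s| <= 5)%N ->
  site_proj R G s * lifted n = if n s == 0 then lifted n else 0.
Proof.
move=> n5; rewrite /lifted /site_proj mulrA -(mulrA (atG _ _)) zero6_excite ffunE.
rewrite residue6_eq0 //; case: eqP => [ns|_]; last by rewrite mulr0 mul0r.
have obl := walks_oblivious ns.
by rewrite (atG_excite _ _ obl) -mulrA atG_psi_projAux.
Qed.

Lemma lifted0 : lifted 0 = P.
Proof.
have -> : lifted 0 = excite R (1 : {perm X})%g (idx0 rot) * P.
  congr (excite R _ _ * _).
    by apply: big1 => t _; rewrite ffunE walk0.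
  by apply/ffunP=> t; rewrite !ffunE; apply: val_inj; rewrite /= !val_idx6.
by rewrite pmx_idx0 ?pmx1 ?mul1r // => s; exact: atI_zero6_projAux.
Qed.

Definition defect_count n : nat := #|[pred s | n s != 0]|.

Lemma defects_lifted n : within 5 n -> D * lifted n = (defect_count n)%:R *: lifted n.
Proof.
move=> n5; rewrite /defects mulr_suml.
under eq_bigr => s _ do rewrite mulrBl mul1r site_proj_lifted //.
rewrite scaler_nat -sumr_const [RHS]big_mkcond; apply: eq_bigr => s _ /=.
by rewrite inE; case: eqP; rewrite ?subrr ?subr0.
Qed.

Lemma at_siteD s k l : at_site s k + at_site s l = at_site s (k + l).
Proof. by apply/ffunP=> t; rewrite !ffunE; case: eqP; rewrite ?addr0. Qed.

Lemma walks_at_site s k : walks (at_site s k) = walk s k.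
Proof.
have -> : walks (at_site s k) = ((\prod_(t : isite rot) 1) * walk s k)%g.
  apply: (@prod_update _ _ _ _ _ s); rewrite ?index_enum_uniq ?mem_index_enum //.
  - by rewrite ffunE eqxx mul1g.
  - by move=> t ts; rewrite ffunE (negbTE ts) walk0.
  by move=> t _; exact: commute1.
by rewrite big1_eq mul1g.
Qed.

Lemma lifted_full_turn s k : residue6 k = idx6 0 ->
  lifted (at_site s k) = pmx R (walk s k) * P.
Proof.
move=> k0; rewrite /lifted walks_at_site (_ : residues _ = idx0 rot).
  by rewrite pmx_idx0 // => t; exact: atI_zero6_projAux.
by apply/ffunP=> t; rewrite !ffunE; case: eqP.
Qed.

End LiftedStates.

(** * Full turns of a clock *)

Section FullTurn.
Variables (R : realType) (G : finGroupType) (E : finType) (rot : {perm dart E}).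
Variables (ev : vertex rot -> 'I_3 -> E) (ep : plaquette rot -> 'I_6 -> E).
Local Notation X := {ffun gsite rot -> G}.
Local Notation Op := 'Op[R]_(config G rot).
Local Notation ket := (@ket R (config G rot)).
Local Notation hop := (@hop G E rot ev ep).
Local Notation walk := (@walk G E rot ev ep).
Local Notation P := (projAux R G rot).
Implicit Types (s t : isite rot).

Lemma walk_m6 s :
  walk s (-6%:Z) = (hop s 5 * hop s 4 * hop s 3 * hop s 2 * hop s 1 * hop s 0)%g.
Proof.
rewrite (_ : - 6%:Z = Negz 5) // /walk !big_ord_recr /= big_ord0 mul1g.
by rewrite /residue6 !val_idx6.
Qed.

(** The forward turn retraces the backward one, so gate products are computed for one direction
    only. *)
Lemma walk_6 s : walk s 6%:Z = (walk s (-6%:Z))^-1%g.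
Proof.
rewrite walk_m6 /walk !big_ord_recr /= big_ord0 mul1g /residue6 !val_idx6 !invMg.
by rewrite !mulgA.
Qed.

Section Vertices.
Variable v : vertex rot.

(** A variable set [A] of edges allows a product of edge operators to be built up one edge at a
    time. *)
Definition star_act (A : pred E) (g : G) (x : X) : X :=
  [ffun t => match t with
             | inl e => if A e then vertex_act v e g (x t) else x t
             | inr _ => x t
             end].

Lemma star_act_inr A g x t : star_act A g x (inr t) = x (inr t).
Proof. by rewrite ffunE. Qed.

Lemma star_act_upd A g x t h : star_act A g (upd x (inr t) h) = upd (star_act A g x) (inr t) h.
Proof.
apply/ffunP=> -[e|t']; rewrite !ffunE //.
Qed.

Lemma upd_star_act (A : pred E) g x e : ~~ A e ->
  upd (star_act A g x) (inl e) (vertex_act v e g (star_act A g x (inl e))) =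
  star_act (predU1 e A) g x.
Proof.
move=> Ae; apply/ffunP=> -[e'|t]; rewrite !ffunE //= (negbTE Ae).
by rewrite (inj_eq (@inl_inj _ _)); case: eqVneq => [->|//].
Qed.

Lemma star_act_ext (A B : pred E) g x : A =1 B -> star_act A g x = star_act B g x.
Proof. by move=> AB; apply/ffunP=> -[e|t]; rewrite !ffunE ?AB. Qed.

Lemma prod_Lop_ket (r : seq E) (A : pred E) g x j : uniq r ->
  (\prod_(e <- r | A e) Lop R g e v : Op) *m ket (x, j) =
  ket (star_act (fun e => (e \in r) && A e) g x, j).
Proof.
elim: r => [|e r IHr] /=.
  move=> _; rewrite big_nil mul1mx; congr (ket (_, _)).
  by apply/ffunP=> -[e|t]; rewrite ffunE.
case/andP => er ur; rewrite big_cons; case: ifP => Ae; last first.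
  rewrite IHr //; congr (ket (_, _)); apply: star_act_ext => e'.
  by rewrite inE; case: eqP => // ->; rewrite Ae andbF.
rewrite mulr_ket IHr // Lop_ket upd_star_act ?negb_and ?er //.
congr (ket (_, _)); apply: star_act_ext => e'.
by rewrite /= inE; case: eqP => // ->; rewrite Ae.
Qed.

Lemma Avertex_ket x j :
  Avertex R G v *m ket (x, j) =
  (#|G|%:R)^-1 *: \sum_g ket (star_act (fun e => e \in star v) g x, j).
Proof.
rewrite -scalemxAl mulmx_suml; congr (_ *: _); apply: eq_bigr => g _.
rewrite prod_Lop_ket ?index_enum_uniq //; congr (ket (_, _)).
by apply: star_act_ext => e; rewrite mem_index_enum.
Qed.

Lemma foldr_vert_perm (r : seq E) x : uniq r ->
  foldr (fun e y => vert_perm G v e y) x r =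
  star_act (fun e => e \in r) (x (inr (inl v))) x.
Proof.
elim: r => [|e r IHr] /=.
  by move=> _; apply/ffunP=> -[e|t]; rewrite ffunE.
case/andP => er ur; rewrite IHr // cpermE star_act_inr upd_star_act //.
Qed.

Lemma star_actK (A : pred E) g x : star_act A g (star_act A g^-1%g x) = x.
Proof.
apply/ffunP=> -[e|t]; rewrite !ffunE //; case: (A e) => //.
rewrite /vertex_act; case: ifP => _; first by rewrite !lmulE mulVKg.
by rewrite !rmulVE invgK mulgK.
Qed.

Hypothesis orbit3 : forall d, #|porbit rot d| = 3.
Hypothesis vertex_ends : forall e, vminus rot e != vplus rot e.
Hypothesis hev : clockwise_star v (ev v).

(** An orbit of three darts gives three distinct edges because the two darts of an edge start at
    different vertices. *)
Lemma clockwise_star_seq :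
  let r := [:: ev v (inord 0); ev v (inord 1); ev v (inord 2)] in
  uniq r /\ forall e, (e \in r) = (e \in star v).
Proof.
have [d dv evE] := hev.
have vE : val v = porbit rot d by rewrite -(mem_vertex dv).
pose q := traject rot d 3.
have qE : [:: ev v (inord 0); ev v (inord 1); ev v (inord 2)] = map fst q.
  by rewrite !evE !inordK //= expg0 perm1 expg1 expgS expg1 permM.
have qT : q = traject rot d #|porbit rot d| by rewrite orbit3.
have uq : uniq q by rewrite qT uniq_traject_porbit.
have memq f : (f \in q) = (source rot f == v).
  rewrite qT -porbit_traject; apply/idP/eqP => [fd|fv].
    by apply: mem_vertex; rewrite vE.
  by rewrite -vE -fv /= porbit_id.
have inE1 e : (e \in map fst q) = (e \in star v).
  rewrite in_set; apply/mapP/orP => [[[e' b]]|].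
    by rewrite memq => /eqP <- /= ->; case: b; [left|right].
  by case=> /eqP ve; [exists (e, true)|exists (e, false)]; rewrite // memq ve.
move=> r; rewrite /r qE; split; last exact: inE1.
rewrite map_inj_in_uniq // => -[e b] [e' b'].
rewrite !memq => /eqP s1 /eqP s2 /= ee; rewrite -ee in s2 *.
case: b b' s1 s2 => -[] // s1 s2; have := vertex_ends e.
  by rewrite /vminus /vplus s1 s2 eqxx.
by rewrite /vminus /vplus s1 s2 eqxx.
Qed.

Lemma walk_m6_vertex x :
  walk (inl v) (-6%:Z) x = star_act (fun e => e \in star v) (x (inr (inl v))) x.
Proof.
have [ur rE] := clockwise_star_seq.
rewrite walk_m6 /= !mul1g !permM -(star_act_ext _ _ rE) -foldr_vert_perm //.
Qed.

Lemma walk_6_vertex x :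
  walk (inl v) 6%:Z x = star_act (fun e => e \in star v) (x (inr (inl v)))^-1%g x.
Proof.
rewrite walk_6; apply: (@perm_inj _ (walk (inl v) (-6%:Z))).
by rewrite permKV walk_m6_vertex star_act_inr star_actK.
Qed.

(** The turn acts on the star by the group element read from [R^v]. The uniform state before it
    averages over that element, giving [A(v)], and the projection after it erases the control value.
    [f] is the identity or inversion, according to the sense of rotation. *)
Lemma vertex_turn (u : {perm X}) (f : G -> G) : injective f ->
  (forall x, u x = star_act (fun e => e \in star v) (f (x (inr (inl v)))) x) ->
  site_proj R G (inl v) * pmx R u * site_proj R G (inl v) =
  Avertex R G v * site_proj R G (inl v).
Proof.
move=> f_inj uE; set Q := site_proj R G (inl v).
have Qket x j : Q *m ket (x, j) =
    if j (inl v) == idx6 0 then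
      (#|G|%:R)^-1 *: \sum_g ket (upd x (inr (inl v)) g, j) else 0.
  rewrite mulr_ket atI_ketbra_ket; case: eqP => [j0|_]; last by rewrite mulmx0.
  rewrite -j0 upd_id atG_ket scaler_sumr; apply: eq_bigr => g _.
  by rewrite /= projPsiVE mxE.
clearbody Q. apply: mx_ket_ext => -[x j]; rewrite !mulr_ket Qket.
case: eqP => [j0|_]; last by rewrite !mulmx0.
rewrite -!scalemxAr; congr (_ *: _); rewrite !mulmx_sumr.
under eq_bigr => h _ do rewrite mulr_ket pmx_ket Qket j0 eqxx.
under [RHS]eq_bigr => k _ do rewrite Avertex_ket.
rewrite -!scaler_sumr; congr (_ *: _).
under eq_bigr => h _ do under eq_bigr => k _ do rewrite uE upd_eq star_act_upd upd_upd.
under [RHS]eq_bigr => k _ do under eq_bigr => h _ do rewrite star_act_upd.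
(* On the left [h] is the control value before the turn and [f h] the acting element; on the right
   the acting element is summed directly. *)
rewrite [RHS]exchange_big /= [RHS](reindex f) //.
exact/onW_bij/injF_bij.
Qed.

End Vertices.
End FullTurn.

(** * Plaquette turns and the orientation of the boundary *)

Lemma prod_rev (gT : finGroupType) (a : nat -> gT) n : (forall x y : gT, x * y = y * x)%g ->
  (\prod_(i < n) a i = \prod_(i < n) a (n - i.+1)%N)%g.
Proof.
move=> mulC; elim: n => [|n IHn]; first by rewrite !big_ord0.
rewrite big_ord_recr [RHS]big_ord_recl /= subn1 mulC IHn.
by congr (_ * _)%g.
Qed.

Section PlaquetteTurn.
Variables (R : realType) (G : finGroupType) (E : finType) (rot : {perm dart E}).
Variables (ev : vertex rot -> 'I_3 -> E) (ep : plaquette rot -> 'I_6 -> E).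
Local Notation X := {ffun gsite rot -> G}.
Local Notation Op := 'Op[R]_(config G rot).
Local Notation ket := (@ket R (config G rot)).
Local Notation hop := (@hop G E rot ev ep).
Local Notation walk := (@walk G E rot ev ep).
Variable p : plaquette rot.
Implicit Types (x : X) (et : 'I_6 -> E).

Definition holonomy (r : seq E) x : G := (\prod_(e <- r) edge_val p e (x (inl e)))%g.

Lemma holonomy_upd r x s g : holonomy r (upd x (inr s) g) = holonomy r x.
Proof. by apply: eq_bigr => e _; rewrite upd_neq. Qed.

Lemma foldr_plaq_perm (r : seq E) x :
  foldr (fun e y => plaq_perm G p e y) x r =
  upd x (inr (inr p)) (holonomy r x * x (inr (inr p)))%g.
Proof.
elim: r => [|e r IHr] /=; first by rewrite /holonomy big_nil mul1g upd_id.
by rewrite IHr cpermE upd_upd upd_eq upd_neq // lmulE /holonomy big_cons mulgA.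
Qed.

Definition boundary (e : 'I_6 -> E) : seq E := [seq e (inord k) | k <- iota 0 6].

Lemma walk_m6_plaquette x :
  walk (inr p) (-6%:Z) x =
  upd x (inr (inr p)) (holonomy (boundary (ep p)) x * x (inr (inr p)))%g.
Proof. by rewrite walk_m6 !permM -foldr_plaq_perm. Qed.

Lemma walk_6_plaquette x :
  walk (inr p) 6%:Z x =
  upd x (inr (inr p)) ((holonomy (boundary (ep p)) x)^-1 * x (inr (inr p)))%g.
Proof.
rewrite walk_6; apply: (@perm_inj _ (walk (inr p) (-6%:Z))).
by rewrite permKV walk_m6_plaquette holonomy_upd upd_upd upd_eq mulKVg upd_id.
Qed.

Definition flux et x : G :=
  (\prod_(i < 6) edge_val p (et (rev_ord i)) (x (inl (et (rev_ord i)))))%g.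

Lemma Bplaquette_ket et x j :
  Bplaquette R G p et *m ket (x, j) = if flux et x == 1%g then ket (x, j) else 0.
Proof.
have prodE (r : seq 'I_6) (g : {ffun 'I_6 -> G}) :
    (\prod_(i <- r) Top R (g i) (et i) p : Op) *m ket (x, j) =
    if all (fun i => edge_val p (et i) (x (inl (et i))) == g i) r then ket (x, j) else 0.
  elim: r => [|i r IHr]; first by rewrite big_nil mul1mx.
  rewrite big_cons mulr_ket IHr /=; case: (all _ r); last by rewrite mulmx0 andbF.
  by rewrite Top_ket andbT.
(* The edge values read off from [x]: the only labelling whose projectors do not annihilate the
   ket. *)
pose k : {ffun 'I_6 -> G} := [ffun i => edge_val p (et i) (x (inl (et i)))].
have -> : flux et x = (\prod_(i < 6) k (rev_ord i))%g.
  by apply: eq_bigr => i _; rewrite ffunE.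
rewrite mulmx_suml big_mkcond (bigD1 k) //= [X in _ + X]big1 ?addr0 => [|g gk]; last first.
  rewrite prodE (_ : all _ _ = false) ?if_same //.
  apply: contraNF gk => /allP gE; apply/eqP/ffunP=> i.
  by rewrite ffunE; apply/esym/eqP/gE; rewrite mem_index_enum.
rewrite prodE (_ : all _ _ = true) //.
by apply/allP=> i _; rewrite ffunE.
Qed.

Section Orientation.
Hypothesis orbit6 : forall d, #|porbit (face rot) d| = 6%N.
Variables (et : 'I_6 -> E) (x : X).
Hypothesis het : clockwise_boundary p et.
Local Notation f := (face rot).

Let hol (d : dart E) : G := edge_val p d.1 (x (inl d.1)).

Let face6 d : (f ^+ 6)%g d = d.
Proof. by rewrite -(orbit6 d) -[RHS](iter_porbit f d) permX. Qed.

Let ccw (d : dart E) : G := (\prod_(i < 6) hol ((f^-1 ^+ i)%g d))%g.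

Let mulg_eq1C (a b : G) : (a * b == 1)%g = (b * a == 1)%g.
Proof. by rewrite -!eq_invg_mul; apply/eqP/eqP=> <-; rewrite invgK. Qed.

(** Changing the starting dart carries one factor from one end of the product to the other, and
    being 1 is invariant under such a cyclic shift. *)
Let ccw_face d : (ccw (f d) == 1%g) = (ccw d == 1%g).
Proof.
rewrite /ccw big_ord_recl [in RHS]big_ord_recr /= mulg_eq1C expg0 perm1.
rewrite (_ : (f^-1 ^+ 5)%g d = f d); last first.
  by rewrite -{1}(face6 d) expgVn expgS permM permK.
congr (_ * _ == _)%g; apply: eq_bigr => i _.
by rewrite /= expgS permM permK.
Qed.

Let ccw_orbit d d' : d' \in porbit f d -> (ccw d' == 1%g) = (ccw d == 1%g).
Proof.
move=> /porbitP[m ->]; elim: m => [|m IHm]; first by rewrite expg0 perm1.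
by rewrite expgSr permM ccw_face.
Qed.

Let face_back d k : (k <= 5)%N -> (f^-1 ^+ k)%g ((f ^+ 5)%g d) = (f ^+ (5 - k))%g d.
Proof. by move=> k5; rewrite -permM -{1}(subnK k5) expgD expgVn mulgK. Qed.

Let flux_ccw : exists2 d, d \in val p & flux et x = ccw d.
Proof.
(* [flux] starts with the last edge of the clockwise list, so its counterclockwise reading starts
   five faces steps after [d]. *)
have [d dp etE] := het; exists ((f ^+ 5)%g d); first exact: plaquette_expg.
apply: eq_bigr => i _; rewrite etE /= -/(hol _); congr (hol _).
by rewrite face_back // -ltnS.
Qed.

(** Reading a clockwise list backwards, as [flux] does, is the same cyclic word as reading a
    counterclockwise list forwards; only the starting dart may differ. *)
Lemma holonomy_counterclockwise ept : counterclockwise_boundary p ept ->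
  (holonomy (boundary ept) x == 1%g) = (flux et x == 1%g).
Proof.
move=> [d dp eE]; have [d' dp' ->] := flux_ccw.
have -> : holonomy (boundary ept) x = ccw d.
  rewrite /holonomy big_map -[iota 0 6]/(index_iota 0 6) big_mkord.
  by apply: eq_bigr => i _; rewrite inord_val eE.
by apply: ccw_orbit; rewrite -(mem_plaquette dp') in dp.
Qed.

Lemma holonomy_clockwise ept : clockwise_boundary p ept -> abelian [set: G] ->
  (holonomy (boundary ept) x == 1%g) = (flux et x == 1%g).
Proof.
move=> [d dp eE] /centsP cG; have [d' dp' ->] := flux_ccw.
have mulC (a b : G) : (a * b = b * a)%g by apply: cG; rewrite inE.
pose d5 := (f ^+ 5)%g d.
have d5p : d5 \in val p by exact: plaquette_expg.
rewrite -(@ccw_orbit d' d5); last by rewrite -(mem_plaquette dp') in d5p.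
congr (_ == _); rewrite /holonomy big_map -[iota 0 6]/(index_iota 0 6) big_mkord.
rewrite (eq_bigr (fun i : 'I_6 => hol ((f ^+ i)%g d))) => [|i _]; last first.
  by rewrite inord_val eE.
rewrite (prod_rev (fun i => hol ((f ^+ i)%g d)) _ mulC).
by apply: eq_bigr => i _; rewrite face_back // -ltnS.
Qed.

End Orientation.
End PlaquetteTurn.

Section GateProducts.
Variables (R : realType) (G : finGroupType) (E : finType) (rot : {perm dart E}).
Variables (ev : vertex rot -> 'I_3 -> E) (ep et : plaquette rot -> 'I_6 -> E).
Hypothesis hL : honeycomb rot.
Hypothesis het : forall p, clockwise_boundary p (et p).
Hypothesis hev : forall v, clockwise_star v (ev v).
Hypothesis hep : forall p, counterclockwise_boundary p (ep p) \/
                     (clockwise_boundary p (ep p) /\ abelian [set: G]).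
Local Notation X := {ffun gsite rot -> G}.
Local Notation Op := 'Op[R]_(config G rot).
Local Notation ket := (@ket R (config G rot)).
Local Notation walk := (@walk G E rot ev ep).
Local Notation lifted := (@lifted R G E rot ev ep).
Local Notation P := (projAux R G rot).
Implicit Types (s t : isite rot) (x : X).

(** Starting from [|1>], the register ends at [h x]. Projecting back keeps the configurations with
    [h x = 1], on which [u] does nothing; since only triviality of [h] matters, both senses of
    rotation give [B(p)]. *)
Lemma plaquette_turn p (u : {perm X}) (h : X -> G) :
  (forall x, u x = upd x (inr (inr p)) (h x * x (inr (inr p)))%g) ->
  (forall x, (h x == 1%g) = (flux p (et p) x == 1%g)) ->
  site_proj R G (inr p) * pmx R u * site_proj R G (inr p) =
  Bplaquette R G p (et p) * site_proj R G (inr p).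
Proof.
move=> uE hE; set Q := site_proj R G (inr p).
have Qket x j : Q *m ket (x, j) =
    if (j (inr p) == idx6 0) && (x (inr (inr p)) == 1%g) then ket (x, j) else 0.
  rewrite mulr_ket atI_ketbra_ket; case: eqP => [j0|_]; last by rewrite mulmx0.
  rewrite -j0 upd_id atG_ketbra_ket /=.
  by case: eqP => // <-; rewrite upd_id.
clearbody Q; apply: mx_ket_ext => -[x j]; rewrite !mulr_ket Qket.
case: ifP => [/andP[j0 /eqP x1]|_]; last by rewrite !mulmx0.
rewrite Bplaquette_ket mulr_ket pmx_ket Qket j0 uE upd_eq x1 mulg1 /= hE.
case: ifP => // /eqP f1; have /eqP -> : h x == 1%g by rewrite hE f1.
by rewrite -x1 upd_id.
Qed.

Definition stabilizer s : Op :=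
  match s with inl v => Avertex R G v | inr p => Bplaquette R G p (et p) end.

Lemma HQD_stabilizer : HQD R G et = - \sum_s stabilizer s.
Proof. by rewrite big_sumType opprD. Qed.

Lemma site_turn s (b : bool) :
  site_proj R G s * pmx R (walk s ((-1) ^+ b * 6%:Z)) * site_proj R G s =
  stabilizer s * site_proj R G s.
Proof.
case: hL => o3 o6 hv hp.
have -> : (-1) ^+ b * 6%:Z = if b then - 6%:Z else 6%:Z :> int.
  by case: b; rewrite ?mulN1r ?mul1r.
case: s => [v|p] /=.
  case: b.
    apply: (@vertex_turn R G E rot v _ id) => [//|x].
    exact: walk_m6_vertex.
  apply: (@vertex_turn R G E rot v _ (fun g => g^-1%g)); first exact: invg_inj.
  by move=> x; exact: walk_6_vertex.
have hol1 x : (holonomy p (boundary (ep p)) x == 1%g) = (flux p (et p) x == 1%g).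
  case: (hep p) => [cc|[cc ab]].
    exact: (holonomy_counterclockwise o6 _ (het p) cc).
  exact: (holonomy_clockwise o6 _ (het p) cc ab).
case: b.
  apply: plaquette_turn => [x|]; first exact: walk_m6_plaquette.
  exact: hol1.
apply: plaquette_turn => [x|]; first exact: walk_6_plaquette.
by move=> x /=; rewrite invg_eq1; exact: hol1.
Qed.

Lemma site_proj_full_turn s (b : bool) :
  site_proj R G s * lifted (at_site s ((-1) ^+ b * 6%:Z)) = stabilizer s * P.
Proof.
rewrite lifted_full_turn; last by case: b; apply: val_inj; rewrite /= !val_idx6.
have compress (Q U A B : Op) : Q * U * Q = B * Q -> Q * A = A -> Q * (U * A) = B * A.
  by move=> h1 h2; rewrite -{1}h2 !mulrA h1 -mulrA h2.
exact: compress (site_turn s b) (site_proj_projAux R G s).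
Qed.

(** [stabilizer s * P] is the [P_s] part of a full turn, and every other clock is at position 0 in
    that turn. Hence [H_QD] preserves the ground space. *)
Lemma projAux_stabilizer s : P * (stabilizer s * P) = stabilizer s * P.
Proof.
apply: projAux_fix => t; rewrite -(site_proj_full_turn s false).
have [->|ts] := eqVneq t s; first by rewrite mulrA site_proj_idem.
have st : (at_site s ((-1) ^+ false * 6%:Z) : {ffun isite rot -> int}) t = 0.
  by rewrite ffunE (negbTE ts).
by rewrite mulrA site_proj_comm -mulrA site_proj_lifted ?st.
Qed.

End GateProducts.

(** * The perturbation series up to sixth order *)

Section RealSpan.
Variables (R : realType) (n : nat).
Local Notation M := 'M[R[i]]_n.

(** The coefficients are real because the coefficient of [P] becomes an energy [g i : R]. *)
Inductive rspan (S : M -> Prop) : M -> Prop :=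
| rspan0 : rspan S 0
| rspanZD (c : R) X Y : S X -> rspan S Y -> rspan S (c%:C *: X + Y).

Variable S : M -> Prop.

Lemma rspan_gen X : S X -> rspan S X.
Proof. by move=> SX; rewrite -[X]addr0 -[X]scale1r; apply: rspanZD => //; exact: rspan0. Qed.

Lemma rspanD X Y : rspan S X -> rspan S Y -> rspan S (X + Y).
Proof.
elim=> [|c Z T SZ ST IH] SY; first by rewrite add0r.
by rewrite -addrA; apply: rspanZD => //; exact: IH.
Qed.

Lemma rspanZ (c : R) X : rspan S X -> rspan S (c%:C *: X).
Proof.
elim=> [|d Z T SZ ST IH]; first by rewrite scaler0; exact: rspan0.
by rewrite scalerDr scalerA -rmorphM; apply: rspanZD.
Qed.

Lemma rspanN X : rspan S X -> rspan S (- X).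
Proof.
move=> SX; have -> : - X = (- 1)%:C *: X by rewrite rmorphN1 scaleN1r.
exact: rspanZ.
Qed.

Lemma rspanB X Y : rspan S X -> rspan S Y -> rspan S (X - Y).
Proof. by move=> SX SY; apply: rspanD => //; exact: rspanN. Qed.

Lemma rspan_sum (I : Type) (r : seq I) (p : pred I) (F : I -> M) :
  (forall k, p k -> rspan S (F k)) -> rspan S (\sum_(k <- r | p k) F k).
Proof. by move=> SF; elim/big_ind: _ => //; [exact: rspan0 | exact: rspanD]. Qed.

End RealSpan.

Lemma rspan_mul (R : realType) n (S S' : 'M[R[i]]_n -> Prop) A X :
  (forall Y, S Y -> rspan S' (A * Y)) -> rspan S X -> rspan S' (A * X).
Proof.
move=> SS'; elim=> [|c Y Z SY _ IH]; first by rewrite mulr0; exact: rspan0.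
rewrite mulrDr; apply: rspanD => //.
by rewrite -[A * _]/(A *m _) -scalemxAr; apply: rspanZ; exact: SS'.
Qed.

Lemma rspan_sub (R : realType) n (S S' : 'M[R[i]]_n -> Prop) X :
  (forall Y, S Y -> rspan S' Y) -> rspan S X -> rspan S' X.
Proof.
move=> SS'; elim=> [|c Y Z SY _ IH]; first exact: rspan0.
by apply: rspanD => //; apply: rspanZ; exact: SS'.
Qed.

Section Recursion.
Variables (R : realType) (G : finGroupType) (E : finType) (rot : {perm dart E}).
Variables (ev : vertex rot -> 'I_3 -> E) (ep : plaquette rot -> 'I_6 -> E).
Hypothesis incV : forall v i, v = vminus rot (ev v i) \/ v = vplus rot (ev v i).
Hypothesis incP : forall p i, p = pminus rot (ep p i) \/ p = pplus rot (ep p i).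
Local Notation Op := 'Op[R]_(config G rot).
Local Notation lifted := (@lifted R G E rot ev ep).
Local Notation blockers := (@blockers E rot ev ep).
Local Notation unblocked := (@unblocked E rot ev ep).
Local Notation P := (projAux R G rot).
Local Notation D := (defects R G rot).
Local Notation V := (Vperturbation R G ev ep).
Local Notation L := {ffun isite rot -> int}.
Implicit Types (s t : isite rot) (n : L).

Definition total n : nat := (\sum_t `|n t|)%N.

Lemma total_at_site s k : total (at_site s k) = `|k|%N.
Proof.
rewrite /total (bigD1 s) //= ffunE eqxx big1 ?addn0 // => t ts.
by rewrite ffunE (negbTE ts).
Qed.

Lemma totalD (n m : L) : (total (n + m)%R <= total n + total m)%N.
Proof. by rewrite /total -big_split; apply: leq_sum => t _; rewrite ffunE /=; lia. Qed.

Lemma at_siteN s k : - at_site s k = at_site s (- k).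
Proof. by apply/ffunP=> t; rewrite !ffunE; case: eqP; rewrite ?oppr0. Qed.

(* States reachable in at most [k] hops, except those where a single clock made
   [k] hops in the same direction. *)
Definition mixed (k : nat) (A : Op) : Prop :=
  exists n, [/\ A = lifted n, (total n <= k)%N & forall t, (`|n t| < k)%N].

Local Notation mspan k := (rspan (mixed k)).

Definition straight (k : nat) : Op :=
  \sum_s (lifted (at_site s k%:Z) + lifted (at_site s (- k%:Z))).

Lemma mixed_le k l A : (k <= l)%N -> mixed k A -> mixed l A.
Proof.
move=> kl [n [-> nk nt]]; exists n; split=> // [|t]; first exact: leq_trans kl.
by apply: leq_trans kl; exact: nt.
Qed.

Lemma mspan_le k l A : (k <= l)%N -> mspan k A -> mspan l A.
Proof. by move=> kl; apply: rspan_sub => B mB; apply: rspan_gen; exact: mixed_le mB. Qed.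

Lemma mspan_straight j k : (j < k)%N -> mspan k (straight j).
Proof.
move=> jk; apply: rspan_sum => s _; apply: rspanD; apply: rspan_gen.
  exists (at_site s j%:Z); split=> // [|t]; first by rewrite total_at_site ltnW.
  by rewrite ffunE; case: eqP => _ //=; apply: leq_trans jk.
exists (at_site s (- j%:Z)); split=> // [|t]; first by rewrite total_at_site abszN ltnW.
by rewrite ffunE; case: eqP => _; rewrite ?abszN //=; apply: leq_trans jk.
Qed.

(** One hop raises the largest position by at most one, so mixed states never feed the straight
    ones. *)
Lemma mspan_V k A : (k <= 5)%N -> mspan k A -> mspan k.+1 (V * A).
Proof.
move=> k5; apply: rspan_mul => B [n [-> nk nt]].
have n5 : within 5 n by move=> t; apply: leq_trans k5; exact/ltnW/nt.
rewrite Vperturbation_lifted //; apply: rspan_sum => s _; apply: rspanD.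
  case: ifP => _; last exact: rspan0.
  apply: rspan_gen; exists (n + at_site s 1); split=> // [|t].
    by apply: leq_trans (totalD _ _) _; rewrite total_at_site addn1.
  by rewrite !ffunE; have := nt t; case: eqP => _ /=; lia.
case: ifP => _; last exact: rspan0.
apply: rspan_gen; exists (n - at_site s 1); split=> // [|t].
  by rewrite at_siteN; apply: leq_trans (totalD _ _) _; rewrite total_at_site addn1.
by rewrite !ffunE; have := nt t; case: eqP => _ /=; lia.
Qed.

(** A mixed state with [n != 0] is removed by dividing by its number of defects, which is positive;
    one with [n = 0] is [P] itself. So the only obstruction to solving is a scalar. *)
Lemma mspan_solve k A : (k <= 6)%N -> mspan k A ->
  exists (B : Op) (c : R), mspan k B /\ D * B + A = c%:C *: P.
Proof.
move=> k6; elim=> [|a _ Z [n [-> nk nt]] _ [B [c [mB eB]]]].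
  by exists 0, 0; split; [exact: rspan0 | rewrite mulr0 scale0r addr0].
have n5 : within 5 n by move=> t; rewrite -ltnS; apply: leq_trans k6; exact: nt.
have [n0|n0] := eqVneq n 0.
  exists B, (a + c); split=> //.
  by rewrite n0 lifted0 addrCA eB rmorphD scalerDl.
pose q : R := (defect_count n)%:R.
have q0 : q != 0.
  rewrite pnatr_eq0 -lt0n; apply/card_gt0P.
  have [s sn] : exists s, n s != 0.
    apply/existsP; apply: contra_neqT n0 => /existsPn n0; apply/ffunP=> t.
    by rewrite ffunE; apply/eqP; have := n0 t; rewrite negbK.
  by exists s; rewrite inE.
exists (B - (a / q)%:C *: lifted n), c; split.
  by apply: rspanB => //; apply: rspanZ; apply: rspan_gen; exists n.
rewrite mulrBr -eB -[D * (_ *: _)]/(D *m _) -scalemxAr [D *m _]defects_lifted //.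
rewrite scalerA -(rmorph_nat (real_complex R)) -rmorphM divfK //.
by rewrite addrA subrK.
Qed.

Lemma D_straight k : (0 < k <= 5)%N -> D * straight k = straight k.
Proof.
move=> /andP[k0 k5]; rewrite mulr_sumr; apply: eq_bigr => s _.
have count1 (b : int) : (`|b| = k)%N -> D * lifted (at_site s b) = lifted (at_site s b).
  move=> bk; rewrite defects_lifted => [|t]; last first.
    by rewrite ffunE; case: eqP => _ //; rewrite bk.
  rewrite (_ : defect_count _ = 1%N) ?scale1r //.
  rewrite -(card1 s); apply: eq_card => t; rewrite !inE ffunE.
  by case: (eqVneq t s) => _; rewrite ?eqxx // -absz_gt0 bk k0.
by rewrite mulrDr !count1 ?abszN.
Qed.

Lemma unblocked_at_site s k i : unblocked (at_site s k) s i.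
Proof.
apply/allP=> t tb; rewrite ffunE; case: (eqVneq t s) => [ts|_]; last by rewrite eqxx.
by rewrite ts in tb; have := @self_blockers E rot ev ep s i; rewrite tb.
Qed.

Lemma V_straight0 : V * P = straight 1.
Proof.
rewrite -(lifted0 R G ev ep) Vperturbation_lifted //; last by move=> t; rewrite ffunE.
apply: eq_bigr => s _; rewrite !ifT.
- by rewrite add0r sub0r at_siteN.
- by apply/allP=> t _; rewrite ffunE.
- by apply/allP=> t _; rewrite ffunE.
Qed.

(** From position k of one clock a hop leads onward to k+1, back to k-1, or to another clock. Only
    the first result is straight; the others have all positions below k+1. *)
Lemma V_straight k : (0 < k <= 5)%N -> mspan k.+1 (V * straight k - straight k.+1).
Proof.
move=> /andP[k0 k5]; rewrite mulr_sumr -sumrB; apply: rspan_sum => s _.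
have within5 (b : int) : (`|b| = k)%N -> within 5 (at_site s b).
  by move=> bk t; rewrite ffunE; case: eqP => _ //; rewrite bk.
have cross (b c : int) t : (`|b| = k)%N -> (`|c| = 1)%N -> t != s ->
    mixed k.+1 (lifted (at_site s b + at_site t c)).
  move=> bk c1 ts; exists (at_site s b + at_site t c); split=> // [|r].
    by apply: leq_trans (totalD _ _) _; rewrite !total_at_site bk c1 addn1.
  rewrite !ffunE; case: (eqVneq r s) => [->|_]; first by rewrite eq_sym (negbTE ts) addr0 bk.
  by case: eqP => _; rewrite add0r ?c1 //; lia.
have back (b : int) : (`|b| < k)%N -> mspan k.+1 (lifted (at_site s b)).
  move=> bk; apply: rspan_gen; exists (at_site s b); split=> // [|t].
    by rewrite total_at_site; lia.
  by rewrite ffunE; case: eqP => _ //; lia.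
have others (b : int) : (`|b| = k)%N ->
    mspan k.+1 (V * lifted (at_site s b) -
      (lifted (at_site s (b + 1)) + lifted (at_site s (b - 1)))).
  move=> bk; rewrite Vperturbation_lifted ?within5 //; last exact: within5.
  rewrite (bigD1 s) //= !unblocked_at_site at_siteN !at_siteD addrC addrK.
  apply: rspan_sum => t ts; apply: rspanD.
    case: ifP => _; last exact: rspan0.
    by apply: rspan_gen; apply: cross.
  case: ifP => _; last exact: rspan0.
  by rewrite at_siteN; apply: rspan_gen; apply: cross.
rewrite mulrDr.
have m1 := rspanD (others k%:Z erefl) (others (- k%:Z) (abszN _)).
have m2 : mspan k.+1 (lifted (at_site s (k%:Z - 1)) + lifted (at_site s (- k%:Z + 1))).
  by apply: rspanD; apply: back; lia.
have -> : k.+1%:Z = k%:Z + 1 by lia.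
have -> : - (k%:Z + 1) = - k%:Z - 1 by lia.
have := rspanD m1 m2.
set a := V * _; set b := V * _; set x1 := lifted _; set x2 := lifted _.
set x3 := lifted _; set x4 := lifted _; clearbody a b x1 x2 x3 x4.
suff -> : a - (x1 + x2) + (b - (x3 + x4)) + (x2 + x3) = a + b - (x1 + x4) by [].
by apply/matrixP=> i j; rewrite !mxE; ring.
Qed.

End Recursion.

(** [x - q i * x] violates the projection [q i] and no other, so it has exactly one defect. *)
Lemma sum_complement_fix (S : pzRingType) (I : finType) (q : I -> S) (i : I) (x : S) :
  (forall j, q j * q i = q i * q j) -> q i * q i = q i ->
  (forall j, j != i -> q j * x = x) ->
  (\sum_j (1 - q j)) * (x - q i * x) = x - q i * x.
Proof.
move=> qC qi qx; rewrite mulr_suml (bigD1 i) //= big1 ?addr0 => [|j ji].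
  by rewrite mulrBl mul1r mulrBr mulrA qi subrr subr0.
by rewrite mulrBl mul1r mulrBr mulrA qC -mulrA (qx j ji) subrr.
Qed.

Lemma subr_rearrange (M : zmodType) (a b d f : M) :
  a - b + d = f + (a + (d - f - b)).
Proof. by rewrite addrCA (addrAC d) (addrC f) subrK -addrA (addrC (- b)). Qed.

Section Series.
Variables (R : realType) (G : finGroupType) (E : finType) (rot : {perm dart E}).
Variables (ev : vertex rot -> 'I_3 -> E) (ep : plaquette rot -> 'I_6 -> E).
Hypothesis incV : forall v i, v = vminus rot (ev v i) \/ v = vplus rot (ev v i).
Hypothesis incP : forall p i, p = pminus rot (ep p i) \/ p = pplus rot (ep p i).
Local Notation Op := 'Op[R]_(config G rot).
Local Notation lifted := (@lifted R G E rot ev ep).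
Local Notation P := (projAux R G rot).
Local Notation D := (defects R G rot).
Local Notation V := (Vperturbation R G ev ep).
Local Notation mspan k := (rspan (@mixed R G E rot ev ep k)).
Local Notation straight := (@straight R G E rot ev ep).

(** The equation is the coefficient of [l^j] in [(H - f) W = 0]. The sign [(-1) ^+ j] arises because
    each order solves by [-1/D], and [D] is 1 on straight states. *)
Definition series_upto (k : nat) (W : nat -> Op) (g : nat -> R) : Prop :=
  W 0 = P /\ forall j, (0 < j <= k)%N ->
    mspan j (W j - ((-1) ^+ j)%:C *: straight j) /\
    D * W j + V * W j.-1 = \sum_(i < j) (g i)%:C *: W (j - i.+1)%N.

Lemma series_source k W g : (k <= 5)%N -> series_upto k W g ->
  mspan k.+1 (V * W k - \sum_(i < k) (g i)%:C *: W (k - i)%N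
              - ((-1) ^+ k)%:C *: straight k.+1).
Proof.
move=> k5 [W0 hW].
have low : mspan k.+1 (\sum_(i < k) (g i)%:C *: W (k - i)%N).
  apply: rspan_sum => i _; apply: rspanZ.
  have ki : (0 < k - i <= k)%N by have := ltn_ord i; lia.
  have [mW _] := hW _ ki.
  rewrite -[W _](subrK (((-1) ^+ (k - i)%N)%:C *: straight (k - i)%N)).
  apply: rspanD; first by apply: mspan_le mW; lia.
  by apply: rspanZ; apply: mspan_straight; lia.
rewrite addrAC; apply: rspanB => //.
case: k k5 hW low => [|k] k5 hW _.
  by rewrite W0 V_straight0 // expr0 scale1r subrr; exact: rspan0.
have kk : (0 < k.+1 <= k.+1)%N by rewrite leqnn.
have [mW _] := hW _ kk.
set c := ((-1) ^+ k.+1)%:C in mW *.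
have -> : V * W k.+1 - c *: straight k.+2 =
    V * (W k.+1 - c *: straight k.+1) + c *: (V * straight k.+1 - straight k.+2).
  rewrite mulrBr -[V * (c *: _)]/(V *m _) -scalemxAr scalerBr addrA subrK.
  by [].
apply: rspanD; first exact: mspan_V mW.
by apply: rspanZ; apply: V_straight.
Qed.

Lemma series_exists k : (k <= 5)%N -> exists W g, series_upto k W g.
Proof.
elim: k => [|k IHk] k5.
  by exists (fun _ => P), (fun _ => 0); split=> // j; case: j.
have [W [g sWg]] := IHk (ltnW k5); have [W0 hW] := sWg.
have [B [c [mB eB]]] := mspan_solve (leqW k5) (series_source (ltnW k5) sWg).
(* [B] disposes of the mixed part of the source. The straight part, fixed by [D], enters with the
   opposite sign, and the remaining multiple [c] of [P] becomes [g k]. *)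
pose W' j := if j == k.+1 then B + ((-1) ^+ k.+1)%:C *: straight k.+1 else W j.
pose g' i := if i == k then c else g i.
have W'E j : (j <= k)%N -> W' j = W j by move=> jk; rewrite /W' ltn_eqF.
have g'E i : (i < k)%N -> g' i = g i by move=> ik; rewrite /g' ltn_eqF.
exists W', g'; split=> [|j /andP[j0]]; first by rewrite W'E.
rewrite leq_eqVlt => /predU1P[->|]; last first.
  rewrite ltnS => jk; have j0k : (0 < j <= k)%N by rewrite j0.
  have [mW eW] := hW j j0k; rewrite !W'E //; last by rewrite (leq_trans (leq_pred _)).
  split=> //; rewrite eW; apply: eq_bigr => i _.
  by rewrite W'E ?g'E //; have := ltn_ord i; lia.
split; first by rewrite /W' eqxx addrK.
rewrite big_ord_recr /= subnn (W'E 0%N) // W0 {2}/g' eqxx -eB.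
rewrite {1}/W' eqxx (W'E k) // mulrDr -[D * (_ *: _)]/(D *m _) -scalemxAr [D *m _]D_straight //.
rewrite (eq_bigr (fun i : 'I_k => (g i)%:C *: W (k - i)%N)) => [|i _]; last first.
  by rewrite g'E // subSS W'E // leq_subr.
rewrite exprS mulN1r rmorphN scaleNr.
exact: subr_rearrange.
Qed.

Variable A : isite rot -> Op.
Hypothesis turnA : forall s (b : bool),
  site_proj R G s * lifted (at_site s ((-1) ^+ b * 6%:Z)) = A s * P.

(* [H_QD] enters here, as the part of the two full turns of each clock that
   lands in the ground space. *)
Lemma series_order6 : exists (W : nat -> Op) (g : nat -> R), W 0 = P /\
  forall k, (k < 7)%N ->
  D *m W k + (if k is k'.+1 then V *m W k' else 0) =
  \sum_(i < 6) \sum_(j < 7 | (i.+1 + j == k)%N) (g i)%:C *: W j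
    + (if k == 6 then - (\sum_s A s * P) *+ 2 else 0).
Proof.
have [W [g sWg]] := series_exists (leqnn 5); have [W0 hW] := sWg.
have [B [c [mB eB]]] := mspan_solve (leqnn 6) (series_source (leqnn 5) sWg).
pose ex s := lifted (at_site s 6%:Z) + lifted (at_site s (- 6%:Z)).
(* After a full turn the clock is back at 0 and the state is no longer an eigenvector of [D]. Its
   [P_s] part lies in the ground space and cannot be solved away; the rest [Y] has one defect. *)
pose Y : Op := \sum_s (ex s - site_proj R G s * ex s).
have exA s : site_proj R G s * ex s = (A s * P) *+ 2.
  have := turnA s false; have := turnA s true.
  by rewrite expr0 expr1 mul1r mulN1r mulrDr => -> ->.
have DY : D * Y = Y.
  rewrite mulr_sumr; apply: eq_bigr => s _.
  apply: sum_complement_fix => [t||t ts].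
  - exact: site_proj_comm.
  - exact: site_proj_idem.
  by rewrite mulrDr !site_proj_lifted ?ffunE ?(negbTE ts).
pose W' j := if j == 6%N then B + Y else W j.
pose g' i := if i == 5%N then c else g i.
exists W', g'; split=> // k k7.
have low j : (j <= 5)%N -> W' j = W j by move=> j5; rewrite /W' ltn_eqF.
have glow i : (i < 5)%N -> g' i = g i by move=> i5; rewrite /g' ltn_eqF.
(* The double sum over orders, needed to compare powers of [l], collapses to the single sum of
   [series_upto]. *)
have sumE : \sum_(i < 6) \sum_(j < 7 | (i.+1 + j == k)%N) (g' i)%:C *: W' j =
    \sum_(i < k) (g' i)%:C *: W' (k - i.+1)%N.
  rewrite (bigID (fun i : 'I_6 => (i < k)%N)) /= [X in _ + X]big1 ?addr0 => [|i ik].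
    rewrite -(big_ord_widen_cond _ xpredT
      (fun i => \sum_(j < 7 | (i.+1 + j == k)%N) (g' i)%:C *: W' j)) //.
    apply: eq_bigr => i _; have ik := ltn_ord i.
    have j7 : (k - i.+1 < 7)%N by lia.
    rewrite (big_pred1 (Ordinal j7)) // => j; rewrite /= -val_eqE /=.
    by apply/eqP/eqP; lia.
  by apply: big_pred0 => j; apply/eqP; lia.
rewrite {}sumE; case: (eqVneq k 6%N) => [k6|k6]; last first.
  have k5 : (k <= 5)%N by lia.
  rewrite addr0 (low k) //.
  case: k k5 {k7 k6} => [|k] k5; first by rewrite big_ord0 addr0 W0; exact: defects_projAux.
  have k0 : (0 < k.+1 <= 5)%N by rewrite k5.
  have [_ eW] := hW _ k0; rewrite low ?(ltnW k5) // [LHS]eW; apply: eq_bigr => i _.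
  by rewrite low ?glow //; have := ltn_ord i; lia.
rewrite {k7}k6 big_ord_recr /= subnn (low 0%N) // W0 {2}/g' eqxx -eB {1}/W' eqxx (low 5%N) //.
rewrite (eq_bigr (fun i : 'I_5 => (g i)%:C *: W (5 - i)%N)) => [|i _]; last first.
  by rewrite glow // subSS low // leq_subr.
rewrite mulmxDr [D *m Y]DY.
have -> : Y = straight 6 - (\sum_s A s * P) *+ 2.
  rewrite /Y sumrB; congr (_ - _); rewrite -sumrMnl.
  by apply: eq_bigr => s _; rewrite exA.
rewrite (_ : ((-1) ^+ 5)%:C = -1 :> R[i]); last first.
  by rewrite -signr_odd /= expr1 rmorphN1.
rewrite scaleN1r mulNrn -[D *m B]/(D * B) -[V *m W 5]/(V * W 5).
rewrite addrA [LHS]addrAC -{1}[straight 6]opprK; congr (_ - _).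
exact: subr_rearrange.
Qed.

End Series.

(** * Assembly of the sixth-order expansion *)

Lemma dagger_Vperturbation (R : realType) (G : finGroupType) (E : finType)
    (rot : {perm dart E}) (ev : vertex rot -> 'I_3 -> E)
    (ep : plaquette rot -> 'I_6 -> E) :
  dagger (Vperturbation R G ev ep) = Vperturbation R G ev ep.
Proof.
rewrite Vperturbation_hopping dagger_sum; apply: eq_bigr => s _.
rewrite dagger_sum; apply: eq_bigr => k _.
by rewrite /plus_hc daggerD daggerK addrC.
Qed.

Theorem mainTheorem3 (R : realType) (G : finGroupType) (E : finType)
    (rot : {perm dart E}) (hL : honeycomb rot)
    (et : plaquette rot -> 'I_6 -> E)
    (het : forall p, clockwise_boundary p (et p))
    (ev : vertex rot -> 'I_3 -> E)
    (hev : forall v, clockwise_star v (ev v))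
    (ep : plaquette rot -> 'I_6 -> E)
    (hep : forall p, counterclockwise_boundary p (ep p) \/
                     (clockwise_boundary p (ep p) /\ abelian [set: G])) :
  exists (f : R -> R) (K lam0 : R), 0 < lam0 /\
    forall lam : R, `|lam| < lam0 ->
    forall Heff Pi : 'Op[R]_(config G rot),
      effective_hamiltonian (Hunperturbed R G rot) (Vperturbation R G ev ep) lam
        Heff Pi ->
      opnorm_le
        (Heff - (f lam)%:C *: Pi
         - (2 * lam ^+ 6)%:C *: (HQD R G et * projAux R G rot))
        (K * `|lam| ^+ 7).
Proof.

have incV v i := clockwise_star_incident i (hev v).
have incP p i : p = pminus rot (ep p i) \/ p = pplus rot (ep p i).
  case: (hep p) => [cc|[cc _]]; first exact: counterclockwise_boundary_incident.
  exact: clockwise_boundary_incident.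
set V := Vperturbation R G ev ep; set D := defects R G rot.
set P := projAux R G rot.
have turn := site_proj_full_turn R hL het hev hep.
have [W [g [W0 recW]]] := series_order6 incV incP turn.
set T := - (\sum_s stabilizer R G et s * P) *+ 2 in recW.
have PT : P * T = T.
  rewrite /T mulrnAr mulrN mulr_sumr; congr (- _ *+ 2).
  by apply: eq_bigr => s _; apply: projAux_stabilizer hL het hev hep s.
have TP : T * P = T.
  rewrite /T mulrnAl mulNr mulr_suml; congr (- _ *+ 2).
  by apply: eq_bigr => s _; rewrite -mulrA projAux_idem.
have PTP : P *m T *m P = T by rewrite [P *m T]PT [T *m P]TP.
pose E0 : R := - #|{: isite rot}|%:R.
have [C [l0 [l0_gt0 expansion]]] := effective_hamiltonian_expansion E0
  (dagger_Vperturbation R G ev ep) (dagger_projAux R G rot)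
  (projAux_idem R G rot) (@defects_gap R G E rot) W0 recW PTP.
exists (energy_shift E0 g), C, l0; split=> // l ll0 Heff Pi.
case=> e [En [phi [ge sb HE PiE]]].
have := ge; rewrite Hunperturbed_defects => ge'.
(* The energy [e] and the dimension in the effective Hamiltonian are those of an arbitrary ground
   energy; here the dimension is matched with [\rank P], as the expansion requires. *)
have [_ rk] := ground_space (dagger_projAux R G rot) (projAux_idem R G rot)
  (@defects_gap R G E rot) (dagger_defects R G rot) (defects_projAux R G rot)
  (projAux_neq0 R G rot) ge'.
rewrite Hunperturbed_defects in HE PiE sb; rewrite rk in HE PiE.
have -> : (2 * l ^+ 6)%:C *: (HQD R G et * P) = (l ^+ 6)%:C *: T.
  rewrite HQD_stabilizer mulNr mulr_suml /T mulrC rmorphM -scalerA; congr (_ *: _).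
  by rewrite rmorph_nat scaler_nat.
by rewrite HE PiE; apply: expansion.
Qed.
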